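(* Let the data satisfy the standing assumptions stated in the context. Let $(u_h^k)_{k\ge0}$ denote the solution of the discrete scheme with boundary data satisfying $u_\partial(t^k)=\hat u_\partial$ for all $t^k\ge t_0$, where $t_0\ge0$ and $\hat u_\partial=(\hat u_\partial(0),\hat u_\partial(\ell))$ is constant in time, and let $\hat u_h\in V_h$ be the solution of the discrete stationary problem with boundary data $\hat u_\partial$. Then there exist positive constants $c_1^*,c_2^*$, independent of the mesh size $h$ and the time step $\tau$, such that $$\|u_h^k-\hat u_h\|_{L^2(0,\ell)}\le c_1^*\,e^{-c_2^*(t^k-t^j)}\,\|u_h^j-\hat u_h\|_{L^2(0,\ell)}\qquad\text{for all } t^k\ge t^j\ge 0 .$$ Moreover, the discrete time differences can be bounded uniformly by $$\sum_{t^k}\tau\,\|d_\tau u_h^k\|_{L^2(0,\ell)}^2\le C .$$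
   Context: Standing assumptions. $\ell>0$ is the interval length, $\alpha>0$ is a constant, and $0<T<\infty$ denotes a time horizon. $\beta\in C^0(\mathbb R)$ is $C^1$ on $\mathbb R\setminus\{0\}$ with $\beta'>0$ there, and $B(u):=\int_0^u\beta(s)\,ds$ is coercive. $\mu\in C^0(\mathbb R)$ with $\mu(0)=0$ is $C^1$ on $\mathbb R\setminus\{0\}$ with $\mu'>0$ there, and $M(s):=\int_0^s\mu(\tilde s)\,d\tilde s$. $u_0\in L^\infty(0,\ell)$ is such that $M(\partial_xu_0)\in L^1(0,\ell)$, and $u_\partial\in W^{1,\infty}((0,\infty)\times\{0,\ell\})$. There are constants $\underline u,\overline u>0$ with $0<\underline u\le u_0,u_\partial\le\overline u$ uniformly in $x$ and $t$. Discretization. $\langle f,g\rangle=\int_0^\ell fg\,dx$ and $\langle f,g\rangle_\partial=f(0)g(0)+f(\ell)g(\ell)$. For $h=\ell/N$ with an integer $N\ge1$ let $x_i=ih$, $0\le i\le N$, and let $V_h$ be the space of continuous functions on $[0,\ell]$ that are affine on each $[x_{i-1},x_i]$. $I_h$ is the nodal interpolation operator into $V_h$ and $\langle a,b\rangle_h=\int_0^\ell I_h(ab)\,dx$. For the time step $\tau>0$: $t^k=k\tau$, $k\ge0$, and $d_\tau a^k=\frac1\tau(a^k-a^{k-1})$. Discrete scheme: $u_h^0=I_hu_0$, and for $k\ge1$, $u_h^k\in V_h$ satisfies $$\langle d_\tau\beta(u_h^k),v_h\rangle_h+\langle\mu(\partial_xu_h^k),\partial_xv_h\rangle+\alpha\langle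 u_h^k,v_h\rangle_\partial=\alpha\langle u_\partial(t^k),v_h\rangle_\partial\qquad\forall v_h\in V_h .$$ This scheme has a unique solution. Discrete stationary problem with boundary data $\hat u_\partial$, $\underline u\le\hat u_\partial\le\overline u$: $\hat u_h\in V_h$ satisfies $$\langle\mu(\partial_x\hat u_h),\partial_xv_h\rangle+\alpha\langle\hat u_h,v_h\rangle_\partial=\alpha\langle\hat u_\partial,v_h\rangle_\partial\qquad\forall v_h\in V_h .$$ It has a unique solution.
   Formalization: Exponential estimate: t^j≥t_0 replaces t^j≥0, τ≤T is required, c_1*,c_2* may depend on T, and t^k≤T is required if û_∂(0)=û_∂(ℓ) and no bound |μ(s)|≥m|s| with m>0 holds near s=0; as printed the estimate fails, e.g. for μ(s)=s³. *)

(* Defs.v *)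
(* MathComp-Analysis *)
From HB Require Import structures.
From mathcomp Require Import all_boot all_order all_algebra.
From mathcomp Require Import all_classical all_reals all_analysis.

Set Implicit Arguments.
Unset Strict Implicit.
Unset Printing Implicit Defensive.
Import Order.TTheory GRing.Theory Num.Theory.
Import numFieldNormedType.Exports.

Local Open Scope classical_set_scope.
Local Open Scope ring_scope.

Section Data.
Context {R : realType}.
Implicit Types (f g : R -> R) (a u ell : R).

(* int_0^u f, with the usual sign for u < 0. *)
Definition primitive0 f u : R :=
  if 0 <= u then \int[lebesgue_measure]_(x in `[0, u]) f x
  else - \int[lebesgue_measure]_(x in `[u, 0]) f x.

Definition coercive f : Prop :=
  forall A, exists r, forall u, r <= `|u| -> A <= f u.

(* Continuous on R, C^1 with positive derivative on R \ {0}; the derivative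
   may vanish or blow up at 0. *)
Definition constitutive f : Prop :=
  continuous f /\
  forall x : R, x != 0 ->
    [/\ derivable f x 1, {for x, continuous (derive1 f)} & 0 < derive1 f x].

Definition test_function (I : set R) (phi : R -> R) : Prop :=
  [/\ forall x, derivable phi x 1, continuous (derive1 phi) &
      exists K, [/\ compact K, K `<=` I & forall x, ~ K x -> phi x = 0]].

Definition weak_derivative (I : set R) f g : Prop :=
  [/\ locally_integrable I f, locally_integrable I g &
      forall phi, test_function I phi ->
        \int[lebesgue_measure]_(x in I) (f x * derive1 phi x) =
        - \int[lebesgue_measure]_(x in I) (g x * phi x)].

(* [u0] is the continuous representative: integrability of M(g) forces g to be
   integrable, and the nodal values of [u0] are used.  The bounds give
   membership in L^oo. *)
Definition initial_datum (mu : R -> R) ell (ulow uup : R) (u0 : R -> R) : Prop :=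
  [/\ {within `[0, ell], continuous u0},
      forall x, x \in `[0, ell] -> ulow <= u0 x <= uup &
      exists g, weak_derivative `]0, ell[ u0 g /\
        (@lebesgue_measure R).-integrable `]0, ell[
          (fun x => (primitive0 mu (g x))%:E)].

(* Functions on (0,oo) x {0, ell} are written [ud t x] and only used at
   x = 0, ell.  W^{1,oo}-regularity is in t; [ud] is the representative that is
   continuous up to t = 0. *)
Definition boundary_datum ell (ulow uup : R) (ud : R -> R -> R) : Prop :=
  forall x, x = 0 \/ x = ell ->
    [/\ {within `[0, +oo[, continuous (ud ^~ x)},
        forall t, 0 <= t -> ulow <= ud t x <= uup &
        exists g, weak_derivative `]0, +oo[ (ud ^~ x) g /\
          exists L, {ae (@lebesgue_measure R), forall t, 0 < t -> `|g t| <= L}].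

End Data.

Section Discretization.
Context {R : realType}.
Variables (ell : R) (N : nat).
Implicit Types (f g v : R -> R).

Definition node (i : nat) : R := i%:R * (ell / N%:R).

(* Elements of V_h are functions on R of which only the restriction to
   [0, ell] is meaningful. *)
Definition Vh v : Prop :=
  {within `[0, ell], continuous v} /\
  forall i, (i < N)%N -> exists a b,
    forall x, x \in `[node i, node i.+1] -> v x = a * x + b.

Definition hat (i : nat) (x : R) : R :=
  Num.max 0 (1 - `|x - node i| / (ell / N%:R)).

Definition Ih f (x : R) : R := \sum_(i < N.+1) f (node i) * hat i x.

Definition inner f g : R :=
  \int[lebesgue_measure]_(x in `[0, ell]) (f x * g x).

Definition inner_h f g : R :=
  \int[lebesgue_measure]_(x in `[0, ell]) Ih (fun y => f y * g y) x.

Definition inner_bd f g : R := f 0 * g 0 + f ell * g ell.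

Definition L2norm f : R := Num.sqrt (inner f f).

Definition dtau (tau : R) (a : nat -> R -> R) (k : nat) (x : R) : R :=
  (a k x - a k.-1 x) / tau.

Variables (alpha : R) (beta mu : R -> R).

(* [derive1 u] is not meaningful at the finitely many nodes, which form a null
   set. *)
Definition discrete_scheme (tau : R) (u0 : R -> R) (ud : R -> R -> R)
    (u : nat -> R -> R) : Prop :=
  [/\ forall k, Vh (u k),
      forall x, x \in `[0, ell] -> u 0%N x = Ih u0 x &
      forall k, (0 < k)%N -> forall v, Vh v ->
        inner_h (dtau tau (fun n => beta \o u n) k) v
        + inner (mu \o derive1 (u k)) (derive1 v)
        + alpha * inner_bd (u k) v
        = alpha * inner_bd (ud (k%:R * tau)) v].

Definition discrete_stationary (ubar uhat : R -> R) : Prop :=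
  Vh uhat /\
  forall v, Vh v ->
    inner (mu \o derive1 uhat) (derive1 v) + alpha * inner_bd uhat v
    = alpha * inner_bd ubar v.

(* Stationary solutions are affine on [0, ell], with a nonzero slope unless
   ubar(0) = ubar(ell).  In that case the slope is 0, where mu may be
   degenerate: for mu(s) = s^3 and constant ubar the decay towards equilibrium
   is only algebraic as t -> oo. *)
Definition nondegenerate_equilibrium (ubar : R -> R) : Prop :=
  ubar 0 = ubar ell ->
  exists m d, [/\ 0 < m, 0 < d & forall s, `|s| <= d -> m * `|s| <= `|mu s|].

End Discretization.

(* Main.v *)
Require Import Defs.
From HB Require Import structures.
From mathcomp Require Import all_boot all_order all_algebra.
From mathcomp Require Import all_classical all_reals all_analysis.
From mathcomp Require Import measurable_realfun ring lra.
Import Order.TTheory GRing.Theory Num.Theory.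
Import numFieldNormedType.Exports.
Local Open Scope classical_set_scope.
Local Open Scope ring_scope.

(* Everything happens on nodal values.  Testing with u^k - uhat and using the
   convexity of the primitive B of beta, the Bregman distance
     B(uhat) - B(u) + beta(u) (u - uhat)
   of the nodal values, integrated by the trapezoidal rule, decreases in each
   step by tau times the dissipation
     <mu(u') - mu(uhat'), u' - uhat'> + alpha |u - uhat|^2 at the boundary.
   The maximum principle keeps u^k in [ulow, uup], away from the singular point 0
   of beta, so that the Bregman distance is equivalent to the squared L^2 norm.
   The slope of uhat is constant and the same for all meshes.  Near it mu is
   strongly increasing, and away from it the dissipation grows at least linearly
   in the slope; since |u - uhat| is bounded, this suffices for the dissipation to
   control the squared L^2 norm, whatever the growth of mu.  Without strong
   monotonicity the energy still does not increase, which is enough on [0, T].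

   For the time differences one tests with u^k - u^(k-1) instead.  The energy
   int M(u') + alpha/2 |u|^2 telescopes; its initial value is bounded by Jensen's
   inequality on each cell, and the work of the boundary data by their total
   variation, which is finite as they are Lipschitz up to t0 and then constant. *)

(** * Convexity and the discrete maximum principle *)

Definition subgradient {R : realType} (B f : R -> R) :=
  forall x y, B x + f x * (y - x) <= B y.

Definition bregman {R : realType} (B f : R -> R) (a u : R) : R :=
  B a - B u + f u * (u - a).

(* [slope] is the derivative of a function of V_h on the i-th cell. *)
Definition slope {R : realType} (h : R) (U : nat -> R) (i : nat) : R :=
  (U i.+1 - U i) / h.

(* The value of inner_h in terms of nodal values: the trapezoidal rule. *)
Definition mass {R : realType} (h : R) (N : nat) (F : nat -> R) : R :=
  \sum_(i < N) h / 2 * (F i + F i.+1).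

(** One form serves both problems: [f] holds the difference quotients of [beta] in a time step and
    is 0 in the stationary problem. *)
Definition nodal_balance {R : realType} (h : R) (N : nat) (alpha : R)
    (mu : R -> R) (f : nat -> R) (d0 d1 : R) (U : nat -> R) :=
  forall V : nat -> R,
    mass h N (fun i => f i * V i)
    + \sum_(i < N) h * (mu (slope h U i) * slope h V i)
    + alpha * (U 0%N * V 0%N + U N * V N) = alpha * (d0 * V 0%N + d1 * V N).

Section Bregman.
Context {R : realType}.
Variables (B f : R -> R).
Hypothesis Bf : subgradient B f.

(** The slack is [bregman B f u v], nonnegative by convexity. This replaces the chain rule in time
    for the implicit Euler step. *)
Lemma bregman_step a u v :
  bregman B f a u - bregman B f a v <= (f u - f v) * (u - a).
Proof. by rewrite /bregman; have := Bf v u; lra. Qed.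

Lemma bregman_ub a u : bregman B f a u <= (f u - f a) * (u - a).
Proof. by rewrite /bregman; have := Bf a u; lra. Qed.

(** Going from [u] to [a] through the midpoint [m], with the subgradients at [u] and at [m], leaves
    [(f u - f m) * (u - m)]. The factor 4 comes from [u - m = (u - a) / 2]. *)
Lemma bregman_lb (b a u : R) :
  b * (u - (u + a) / 2) ^+ 2
    <= (f u - f ((u + a) / 2)) * (u - (u + a) / 2) ->
  b / 4 * (u - a) ^+ 2 <= bregman B f a u.
Proof.
set m := (u + a) / 2 => H; rewrite /bregman.
have um : u - m = (u - a) / 2 by rewrite /m; field.
have am : a - m = (a - u) / 2 by rewrite /m; field.
have mu : m - u = (a - u) / 2 by rewrite /m; field.
have := Bf u m; have := Bf m a; rewrite mu am.
by move: H; rewrite um; nra.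
Qed.

End Bregman.

Section Mass.
Context {R : realType}.
Variables (h : R) (N : nat).
Lemma mass_le F G : 0 < h ->
  (forall i, (i <= N)%N -> F i <= G i) -> mass h N F <= mass h N G.
Proof.
move=> h0 FG; apply: ler_sum => i _; apply: ler_wpM2l; first by lra.
by apply: lerD; apply: FG; [exact: ltnW|].
Qed.

Lemma mass_ge0 F : 0 < h -> (forall i, (i <= N)%N -> 0 <= F i) -> 0 <= mass h N F.
Proof.
move=> h0 F0; apply: sumr_ge0 => i _; apply: mulr_ge0; first by lra.
by apply: addr_ge0; apply: F0; [exact: ltnW|].
Qed.

Lemma massB F G : mass h N (fun i => F i - G i) = mass h N F - mass h N G.
Proof.
by rewrite /mass -sumrB; apply: eq_bigr => i _; lra.
Qed.

Lemma massZ c F : mass h N (fun i => c * F i) = c * mass h N F.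
Proof. by rewrite /mass mulr_sumr; apply: eq_bigr => i _; ring. Qed.

Lemma mass_cst c : mass h N (fun=> c) = N%:R * h * c.
Proof.
by rewrite /mass sumr_const card_ord -[LHS]mulr_natl; field.
Qed.

Lemma eq_mass F G : (forall i, (i <= N)%N -> F i = G i) -> mass h N F = mass h N G.
Proof.
by move=> FG; apply: eq_bigr => i _; rewrite !FG// ltnW.
Qed.

End Mass.

Section Monotone.
Context {R : realType}.
Variable mu : R -> R.
Hypothesis mu_incr : {homo mu : x y / x < y}.

Lemma mono_mul_ge0 x y : 0 <= (mu x - mu y) * (x - y).
Proof.
have [xy|xy|->] := ltgtP x y; last by rewrite !subrr mulr0.
- by have := mu_incr _ _ xy; nra.
- by have := mu_incr _ _ xy; nra.
Qed.

Lemma mono_mul_eq0 x y : (mu x - mu y) * (x - y) = 0 -> x = y.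
Proof.
have [xy|xy|->] := ltgtP x y => //.
- by have := mu_incr _ _ xy; nra.
- by have := mu_incr _ _ xy; nra.
Qed.

End Monotone.

Section MaxPrinciple.
Context {R : realType}.
Variables (h alpha : R) (N : nat).

(** The test sequence is the positive part of [U - M]. Accumulation, flux and boundary terms are
    then all nonnegative, hence all vanish. *)
Lemma nodal_le_max (mu : R -> R) (f : nat -> R) (d0 d1 : R) (U : nat -> R) (M : R) :
  0 < h -> 0 < alpha -> {homo mu : x y / x < y} -> mu 0 = 0 ->
  nodal_balance h N alpha mu f d0 d1 U -> d0 <= M -> d1 <= M ->
  (forall i, (i <= N)%N -> M < U i -> 0 <= f i) ->
  forall i, (i <= N)%N -> U i <= M.
Proof.
move=> h0 alpha0 mu_incr mu0 bal d0M d1M fM.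
pose V i := Num.max 0 (U i - M).
have V0 i : 0 <= V i by rewrite /V le_max lexx.
have VU i : U i - M <= V i by rewrite /V le_max lexx orbT.
have VE i : V i = 0 \/ V i = U i - M.
  by rewrite /V; case: (leP 0 (U i - M)) => _; [right|left].
(* Truncation is monotone, so the slopes of [V] never have the sign opposite to those of [U]: each
   flux term is nonnegative. *)
have Vmono i j : U i <= U j -> V i <= V j.
  by case: (VE i) => ->; [move=> _; exact: V0|have := VU j; lra].
have t1 : 0 <= mass h N (fun i => f i * V i).
  apply: mass_ge0 => // i iN; have [->|VM] := VE i; first by rewrite mulr0.
  have [->|Vn] := eqVneq (V i) 0; first by rewrite mulr0.
  rewrite mulr_ge0// fM//; have := V0 i; rewrite le_eqVlt eq_sym (negbTE Vn)/=.
  by rewrite VM; lra.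
have mus x : (0 < x -> 0 < mu x) /\ (x < 0 -> mu x < 0).
  by split => /mu_incr; rewrite mu0.
have t2 (i : 'I_N) : true -> 0 <= h * (mu (slope h U i) * slope h V i).
  move=> _; apply: mulr_ge0; first exact: ltW.
  rewrite /slope; set s := (U i.+1 - U i) / h.
  rewrite mulrA; apply: mulr_ge0; last by rewrite invr_ge0 ltW.
  have [s1 s2] := mus s.
  have [sn|sp|s0] := ltgtP s 0.
  - have Us : U i.+1 - U i < 0 by move: sn; rewrite /s pmulr_llt0 ?invr_gt0.
    apply: mulr_le0; first exact/ltW/s2.
    by rewrite subr_le0; apply: Vmono; lra.
  - have Us : 0 < U i.+1 - U i by move: sp; rewrite /s pmulr_lgt0 ?invr_gt0.
    apply: mulr_ge0; first exact/ltW/s1.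
    by rewrite subr_ge0; apply: Vmono; lra.
  - by rewrite s0 mu0 mul0r.
have := bal V.
set S := \sum_(i < N) _; have S0 : 0 <= S by exact: sumr_ge0.
(* As [d <= M], the boundary terms control [V ^+ 2]; so [V] vanishes at node 0, where the induction
   over the cells starts. *)
have bd d (dM : d <= M) i : V i ^+ 2 <= (U i - d) * V i.
  rewrite -subr_ge0; have [->|VM] := VE i; first by rewrite mulr0 expr0n subr0.
  have -> : (U i - d) * V i - V i ^+ 2 = (M - d) * V i.
    by rewrite VM; ring.
  by rewrite mulr_ge0// subr_ge0.
move=> E; have b0 := ler_wpM2l (ltW alpha0) (bd _ d0M 0%N).
have b1 := ler_wpM2l (ltW alpha0) (bd _ d1M N).
have q0 := mulr_ge0 (ltW alpha0) (sqr_ge0 (V 0%N)).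
have q1 := mulr_ge0 (ltW alpha0) (sqr_ge0 (V N)).
have Sle : S = 0 by lra.
have VV0 : V 0%N = 0.
  have /eqP : alpha * V 0%N ^+ 2 = 0 by lra.
  by rewrite mulf_eq0 (gt_eqF alpha0)/= sqrf_eq0 => /eqP.
have {}Sle := psumr_eq0P t2 Sle.
(* If [V i = 0] and the flux term of cell [i] vanishes, then either [V i.+1 = 0], or the slope of
   [U] is 0 and [U i.+1 = U i] does not exceed [M]. *)
have Vall i : (i <= N)%N -> V i = 0.
  elim: i => [//|i IH] iN; have Vi := IH (ltnW iN).
  have /eqP := Sle (Ordinal iN) isT; rewrite /= /slope Vi subr0.
  rewrite mulf_eq0 gt_eqF//= mulf_eq0 mulf_eq0 invr_eq0 (gt_eqF h0) orbF.
  move=> /orP[|/eqP//] /eqP mz.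
  have : U i.+1 - U i = 0.
    have [sn|sp|->//] := ltgtP (U i.+1 - U i) 0.
    - have /(proj2 (mus _)) : (U i.+1 - U i) / h < 0 by rewrite pmulr_llt0 ?invr_gt0.
      by rewrite mz ltxx.
    - have /(proj1 (mus _)) : 0 < (U i.+1 - U i) / h by rewrite pmulr_lgt0 ?invr_gt0.
      by rewrite mz ltxx.
  by have := VU i; have := V0 i.+1; case: (VE i.+1) => ->; lra.
by move=> i iN; have := VU i; rewrite Vall//; lra.
Qed.

(** By reflection: [- U] solves the balance for the flux [- mu (- x)], which is again increasing,
    with [f], [d0] and [d1] negated. *)
Lemma nodal_ge_min (mu : R -> R) (f : nat -> R) (d0 d1 : R) (U : nat -> R) (M : R) :
  0 < h -> 0 < alpha -> {homo mu : x y / x < y} -> mu 0 = 0 ->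
  nodal_balance h N alpha mu f d0 d1 U -> M <= d0 -> M <= d1 ->
  (forall i, (i <= N)%N -> U i < M -> f i <= 0) ->
  forall i, (i <= N)%N -> M <= U i.
Proof.
move=> h0 alpha0 mu_incr mu0 bal d0M d1M fM i iN; rewrite -lerN2.
apply: (@nodal_le_max (fun x => - mu (- x)) (fun i => - f i) (- d0) (- d1)
  (fun i => - U i) (- M)) => //; rewrite ?oppr0 ?mu0 ?oppr0 ?lerN2//.
- by move=> x y xy; rewrite ltrN2 mu_incr// ltrN2.
- move=> V; have := bal V.
  have -> : mass h N (fun i => - f i * V i) = - mass h N (fun i => f i * V i).
    by rewrite -mulN1r -massZ; apply: eq_mass => j _; ring.
  have -> : \sum_(i < N) h * (- mu (- slope h (fun i => - U i) i) * slope h V i)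
      = - \sum_(i < N) h * (mu (slope h U i) * slope h V i).
    rewrite -sumrN; apply: eq_bigr => j _.
    have -> : - slope h (fun i => - U i) j = slope h U j by rewrite /slope; ring.
    by ring.
  by lra.
- by move=> j jN; rewrite ltrN2 => /(fM _ jN); rewrite oppr_ge0.
Qed.

End MaxPrinciple.

(** * Energy dissipation *)

Lemma sum_slope {R : realType} (h : R) N U : h != 0 ->
  \sum_(i < N) h * slope h U i = U N - U 0%N.
Proof.
move=> h0; elim: N => [|N IH]; first by rewrite big_ord0 subrr.
by rewrite big_ord_recr/= IH /slope; field.
Qed.

Lemma sum_const_slope {R : realType} (h c : R) N V :
  \sum_(i < N) h * (c * slope h V i) = c * \sum_(i < N) h * slope h V i.
Proof. by rewrite mulr_sumr; apply: eq_bigr => i _; ring. Qed.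

Section Contraction.
Context {R : realType}.
Variables (h alpha : R) (N : nat) (mu : R -> R).

(** The test sequence is [U] minus the affine interpolant of its end values. It vanishes at both
    ends, which leaves a zero sum of the nonnegative terms of strict monotonicity. The equation for
    [s] involves the mesh only through the length [N%:R * h]. *)
Lemma stationary_slope (d0 d1 : R) (U : nat -> R) :
  0 < h -> (0 < N)%N -> {homo mu : x y / x < y} ->
  nodal_balance h N alpha mu (fun=> 0) d0 d1 U ->
  let s := (U N - U 0%N) / (N%:R * h) in
  (forall i, (i < N)%N -> slope h U i = s) /\
  2 * mu s + alpha * (N%:R * h) * s = alpha * (d1 - d0).
Proof.
move=> h0 N0 mu_incr bal s.
have hn0 : h != 0 by rewrite gt_eqF.
have Nh0 : 0 < N%:R * h by rewrite mulr_gt0// ltr0n.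
have NhsE : N%:R * h * s = U N - U 0%N by rewrite /s; field; rewrite gt_eqF// pnatr_eq0 -lt0n.
have mass0 V : mass h N (fun i => 0 * V i) = 0.
  by rewrite /mass big1// => i _; rewrite !mul0r addr0 mulr0.
have slopes i : (i < N)%N -> slope h U i = s.
  pose V i := U i - (U 0%N + i%:R * h * s).
  have VS j : slope h V j = slope h U j - s.
    by rewrite /slope /V -natr1; field.
  have V0 : V 0%N = 0 by rewrite /V; lra.
  have VN : V N = 0 by rewrite /V NhsE; lra.
  have := bal V; rewrite mass0 V0 VN !mulr0 !addr0 !mulr0 addr0 add0r => E.
  have E2 : \sum_(i < N) h * ((mu (slope h U i) - mu s) * (slope h U i - s)) = 0.
    have := sum_const_slope h (mu s) N V; rewrite (sum_slope _ N V hn0) V0 VN subrr mulr0 => E3.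
    transitivity (\sum_(i < N) h * (mu (slope h U i) * slope h V i)
                  - \sum_(i < N) h * (mu s * slope h V i)).
      by rewrite -sumrB; apply: eq_bigr => j _; rewrite VS; ring.
    by rewrite E E3 subrr.
  move=> iN; have ge0 (j : 'I_N) : true ->
      0 <= h * ((mu (slope h U j) - mu s) * (slope h U j - s)).
    by move=> _; apply: mulr_ge0; [exact: ltW|exact: mono_mul_ge0].
  have /(_ (Ordinal iN) isT)/eqP := psumr_eq0P ge0 E2.
  rewrite mulf_eq0 (gt_eqF h0)/= => /eqP; exact: mono_mul_eq0.
(* The centred coordinate has slope 1 and opposite end values, so [U] enters the boundary term only
   through [U N - U 0%N]. *)
split=> //; have := bal (fun i => i%:R * h - N%:R * h / 2).
rewrite mass0 add0r mul0r add0r.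
have -> : \sum_(i < N) h * (mu (slope h U i) *
    slope h (fun i => i%:R * h - N%:R * h / 2) i) = N%:R * h * mu s.
  transitivity (\sum_(i < N) h * mu s).
    by apply: eq_bigr => i _; rewrite slopes// /slope -natr1; field.
  by rewrite sumr_const card_ord -[LHS]mulr_natl mulrA.
move=> E; have : N%:R * h * (2 * mu s + alpha * (N%:R * h) * s - alpha * (d1 - d0)) = 0.
  rewrite !mulrDr [_ * (alpha * _ * s)](_ : _ = N%:R * h * alpha * (U N - U 0%N));
    last by rewrite -NhsE; ring.
  by lra.
by move=> /eqP; rewrite mulf_eq0 (gt_eqF Nh0)/= subr_eq0 => /eqP.
Qed.

(** Both balances are tested with [U - Us] and subtracted, so that the boundary data cancel;
    [bregman_step] bounds the change of the Bregman distance by the accumulation term. *)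
Lemma contraction_step (beta B : R -> R) (tau d0 d1 : R) (U U' Us : nat -> R) :
  0 < h -> 0 < tau -> subgradient B beta ->
  nodal_balance h N alpha mu (fun i => (beta (U i) - beta (U' i)) / tau) d0 d1 U ->
  nodal_balance h N alpha mu (fun=> 0) d0 d1 Us ->
  mass h N (fun i => bregman B beta (Us i) (U i))
  + tau * (\sum_(i < N) h * ((mu (slope h U i) - mu (slope h Us i))
                             * (slope h U i - slope h Us i))
           + alpha * ((U 0%N - Us 0%N) ^+ 2 + (U N - Us N) ^+ 2))
  <= mass h N (fun i => bregman B beta (Us i) (U' i)).
Proof.
move=> h0 tau0 Bb balU balUs.
pose V i := U i - Us i.
have := balU V; have := balUs V.
have -> : mass h N (fun i => 0 * V i) = 0.
  by rewrite /mass big1// => i _; rewrite !mul0r addr0 mulr0.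
have -> : mass h N (fun i => (beta (U i) - beta (U' i)) / tau * V i)
   = tau^-1 * mass h N (fun i => (beta (U i) - beta (U' i)) * V i).
  by rewrite -massZ; apply: eq_mass => i _; ring.
have -> : \sum_(i < N) h * ((mu (slope h U i) - mu (slope h Us i))
        * (slope h U i - slope h Us i)) =
    \sum_(i < N) h * (mu (slope h U i) * slope h V i)
    - \sum_(i < N) h * (mu (slope h Us i) * slope h V i).
  rewrite -sumrB; apply: eq_bigr => i _.
  have -> : slope h V i = slope h U i - slope h Us i by rewrite /slope /V; ring.
  by ring.
have : mass h N (fun i => bregman B beta (Us i) (U i))
  - mass h N (fun i => bregman B beta (Us i) (U' i))
  <= mass h N (fun i => (beta (U i) - beta (U' i)) * V i).
  by rewrite -massB; apply: mass_le => // i _; exact: bregman_step.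
set S' := \sum_(i < N) _; set S := \sum_(i < N) _.
set m := mass _ _ (fun i => _ * V i).
have : m = tau * (tau^-1 * m) by rewrite mulrA mulfV ?mul1r// gt_eqF.
move: (tau^-1 * m) => n -> Hm E1 E2.
have {E1 E2} E : n = - (S - S' + alpha * (V 0%N ^+ 2 + V N ^+ 2)).
  by rewrite /V !expr2 in E1 E2 *; lra.
by move: Hm; rewrite {}E /V; lra.
Qed.

End Contraction.

(** A discrete embedding of W^{1,1} into L^oo, with constant 1 on every mesh. *)
Lemma sum_dist {R : realType} (h : R) (N : nat) (W : nat -> R) i : 0 < h ->
  (i <= N)%N -> `|W i - W 0%N| <= \sum_(j < N) h * `|slope h W j|.
Proof.
move=> h0 iN; apply: (@le_trans _ _ (\sum_(j < i) h * `|slope h W j|)).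
  rewrite -(sum_slope h i W) ?gt_eqF//; apply: le_trans (ler_norm_sum _ _ _) _.
  by apply: ler_sum => j _; rewrite normrM (gtr0_norm h0).
rewrite -(big_mkord xpredT (fun j => h * `|slope h W j|)).
rewrite -(big_mkord xpredT (fun j => h * `|slope h W j|)).
rewrite (big_cat_nat _ iN)//= lerDl.
by apply: sumr_ge0 => j _; rewrite mulr_ge0// ltW.
Qed.

(** [W] stands for [U - Us] and [phi] for the dissipation density, whose lower bound is quadratic
    for slopes below [d] but only linear above. Large dissipation is handled by the bound [M], small
    dissipation by summing slopes. *)
Lemma dissipation_coercive {R : realType} (ell alpha m d M : R) :
  0 < ell -> 0 < alpha -> 0 < m -> 0 < d -> 0 < M ->
  exists2 C, 0 < C & forall (h : R) (N : nat) (W phi : nat -> R),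
    0 < h -> N%:R * h = ell -> (forall i, (i <= N)%N -> `|W i| <= M) ->
    (forall i, (i < N)%N -> 0 <= phi i) ->
    (forall i, (i < N)%N -> `|slope h W i| <= d ->
       m * slope h W i ^+ 2 <= phi i) ->
    (forall i, (i < N)%N -> d <= `|slope h W i| ->
       m * d * `|slope h W i| <= phi i) ->
  forall i, (i <= N)%N ->
    W i ^+ 2 <= C * (\sum_(j < N) h * phi j + alpha * (W 0%N ^+ 2 + W N ^+ 2)).
Proof.
move=> ell0 alpha0 m0 d0 M0.
(* [C1] serves small dissipation: [k] measures the distance to [W 0%N] in units of [x], and
   [2 / alpha] accounts for [W 0%N] itself. [C2] serves dissipation above [d ^+ 2]. *)
pose k := ell + m^-1; have k0 : 0 < k by rewrite addr_gt0// invr_gt0.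
pose C1 := 2 / alpha + 2 * k ^+ 2; pose C2 := M ^+ 2 / d ^+ 2.
have C10 : 0 < C1 by rewrite /C1 addr_gt0 ?divr_gt0// mulr_gt0// exprn_gt0.
have C20 : 0 < C2 by rewrite /C2 divr_gt0 ?exprn_gt0.
exists (C1 + C2); first exact: addr_gt0.
move=> h N W phi h0 NhE WM phi0 phi1 phi2 i iN.
set D := _ + alpha * _.
have S0 : 0 <= \sum_(j < N) h * phi j.
  by apply: sumr_ge0 => j _; rewrite mulr_ge0 ?phi0// ltW.
have W0D : alpha * W 0%N ^+ 2 <= D.
  by have := mulr_ge0 (ltW alpha0) (sqr_ge0 (W N)); rewrite /D; lra.
have SD : \sum_(j < N) h * phi j <= D.
  have := mulr_ge0 (ltW alpha0) (sqr_ge0 (W N)).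
  by have := mulr_ge0 (ltW alpha0) (sqr_ge0 (W 0%N)); rewrite /D; lra.
have D0 : 0 <= D by exact: le_trans SD.
(* Adding [e] keeps the square root [x], by which slopes are compared, positive even if [D = 0]. *)
suff key e : 0 < e -> W i ^+ 2 <= (C1 + C2) * (D + e).
  apply/ler_addgt0Pr => e e0; have C0 : 0 < C1 + C2 by exact: addr_gt0.
  have := key (e / (C1 + C2)); rewrite divr_gt0// => /(_ isT).
  by rewrite mulrDr mulrCA mulfV ?mulr1// gt_eqF.
move=> e0; have De : 0 < D + e by rewrite ltr_wpDl.
have [Ded|dDe] := leP (D + e) (d ^+ 2); last first.
  apply: (@le_trans _ _ (C2 * (D + e))); last first.
    by apply: ler_wpM2r; [exact: ltW|rewrite lerDr ltW].
  apply: (@le_trans _ _ (C2 * d ^+ 2)); last by rewrite ler_pM2l// ltW.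
  rewrite /C2 divfK ?gt_eqF ?exprn_gt0// -real_normK ?num_real//.
  by rewrite ler_sqr ?nnegrE ?normr_ge0 ?(ltW M0)//; exact: WM.
apply: (@le_trans _ _ (C1 * (D + e))); last first.
  by apply: ler_wpM2r; [exact: ltW|rewrite lerDl ltW].
pose x := Num.sqrt (D + e); have x0 : 0 < x by rewrite sqrtr_gt0.
have xE : x ^+ 2 = D + e by rewrite sqr_sqrtr// ltW.
have xd : x <= d by rewrite -ler_sqr ?nnegrE ?(ltW x0) ?(ltW d0)// xE.
(* Both alternatives in the hypotheses on phi give this bound as x <= d; it is
   summed over the cells with x ^ 2 close to D. *)
have pt j : (j < N)%N -> `|slope h W j| <= x + phi j / (m * x).
  move=> jN; have mx0 : 0 < m * x by exact: mulr_gt0.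
  have [sd|/ltW ds] := leP `|slope h W j| d; last first.
    have := phi2 _ jN ds; set s := `|_| => H.
    apply: (@le_trans _ _ (phi j / (m * x))); last by rewrite lerDr ltW.
    rewrite ler_pdivlMr//; apply: le_trans H.
    rewrite mulrC; apply: ler_wpM2r; first exact: normr_ge0.
    by apply: ler_wpM2l => //; exact: ltW.
  have := phi1 _ jN sd; rewrite -real_normK ?num_real//.
  have := normr_ge0 (slope h W j); set s := `|_| => s0 H.
  have [sx|xs] := leP s x.
    by rewrite (le_trans sx)// lerDl divr_ge0 ?phi0// ltW.
  apply: (@le_trans _ _ (phi j / (m * x))); last by rewrite lerDr ltW.
  rewrite ler_pdivlMr//; apply: le_trans H.
  rewrite mulrC -mulrA; apply: ler_wpM2l; first exact: ltW.
  by rewrite expr2; apply: ler_wpM2r => //; exact: ltW.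
have dist : `|W i - W 0%N| <= k * x.
  apply: le_trans (sum_dist h N W i h0 iN) _.
  apply: (@le_trans _ _ (\sum_(j < N) (h * x + (m * x)^-1 * (h * phi j)))).
    apply: ler_sum => j _; apply: le_trans (ler_wpM2l (ltW h0) (pt _ (ltn_ord j))) _.
    by rewrite mulrDr lerD2l mulrA [leRHS]mulrC.
  rewrite big_split/= sumr_const card_ord -mulr_natl mulrA NhE -mulr_sumr.
  have -> : k * x = ell * x + (m * x)^-1 * x ^+ 2 by rewrite /k; field; rewrite !gt_eqF.
  rewrite lerD2l ler_pM2l ?invr_gt0 ?mulr_gt0// xE.
  by apply: le_trans SD _; rewrite lerDl ltW.
have W0x : W 0%N ^+ 2 <= x ^+ 2 / alpha.
  by rewrite ler_pdivlMr// mulrC xE; lra.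
have : W i ^+ 2 <= 2 * W 0%N ^+ 2 + 2 * (W i - W 0%N) ^+ 2.
  by have := sqr_ge0 (W i - 2 * W 0%N); rewrite !expr2; lra.
have : (W i - W 0%N) ^+ 2 <= k ^+ 2 * x ^+ 2.
  rewrite -exprMn -real_normK ?num_real// ler_sqr ?nnegrE ?normr_ge0//.
  exact/ltW/mulr_gt0.
rewrite -xE /C1; move: W0x; lra.
Qed.

(** Products make the bounds symmetric in [x] and [y]; for [b0 > 0] they say that [f] is strongly
    monotone and Lipschitz. *)
Definition bilipschitz_on {R : realType} (lo up b0 b1 : R) (f : R -> R) :=
  forall x y, lo <= x <= up -> lo <= y <= up ->
    b0 * (x - y) ^+ 2 <= (f x - f y) * (x - y) <= b1 * (x - y) ^+ 2.

(** The alternatives are those of [dissipation_coercive], for the deviation of a slope from [s].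
    Linear growth far from [s] is what monotonicity alone can give. *)
Definition strongly_increasing_at {R : realType} (m d : R) (f : R -> R) (s : R) :=
  forall x,
    (`|x - s| <= d -> m * (x - s) ^+ 2 <= (f x - f s) * (x - s)) /\
    (d <= `|x - s| -> m * d * `|x - s| <= (f x - f s) * (x - s)).

Lemma bregman_bounds {R : realType} (lo up b0 b1 : R) (B f : R -> R) (a u : R) :
  subgradient B f -> bilipschitz_on lo up b0 b1 f ->
  lo <= a <= up -> lo <= u <= up ->
  b0 / 4 * (u - a) ^+ 2 <= bregman B f a u <= b1 * (u - a) ^+ 2.
Proof.
move=> Bf fb ai ui; apply/andP; split; last first.
  apply: le_trans (bregman_ub _ _ Bf a u) _.
  by have /andP[_] := fb _ _ ui ai.
apply: bregman_lb => //; have := fb u ((u + a) / 2) ui => /(_ _)/andP[]//.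
by move: ai ui => /andP[? ?] /andP[? ?]; lra.
Qed.

(** [dissipation_coercive] bounds the squared difference at every node by [C * D]. Summed with total
    mass [ell] this gives [E <= b1 * ell * C * D], and the rate is the inverse of that constant. *)
Lemma energy_step {R : realType} (ell alpha lo up b0 b1 m d s : R)
    (beta B mu : R -> R) :
  0 < ell -> 0 < alpha -> lo < up -> 0 < b1 ->
  subgradient B beta -> bilipschitz_on lo up b0 b1 beta ->
  {homo mu : x y / x < y} -> 0 < m -> 0 < d -> strongly_increasing_at m d mu s ->
  exists2 c, 0 < c & forall (h : R) (N : nat) (tau d0 d1 : R) (U U' Us : nat -> R),
    0 < h -> N%:R * h = ell -> 0 < tau ->
    nodal_balance h N alpha mu (fun i => (beta (U i) - beta (U' i)) / tau) d0 d1 U ->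
    nodal_balance h N alpha mu (fun=> 0) d0 d1 Us ->
    (forall i, (i <= N)%N -> lo <= U i <= up) ->
    (forall i, (i <= N)%N -> lo <= Us i <= up) ->
    (forall i, (i < N)%N -> slope h Us i = s) ->
    (1 + c * tau) * mass h N (fun i => bregman B beta (Us i) (U i))
    <= mass h N (fun i => bregman B beta (Us i) (U' i)).
Proof.
move=> ell0 alpha0 loup b10 Bb bb mu_incr m0 d0 smu.
have M0 : 0 < up - lo by rewrite subr_gt0.
have [C C0 HC] := dissipation_coercive ell alpha m d (up - lo) ell0 alpha0 m0 d0 M0.
have K0 : 0 < b1 * ell * C by rewrite !mulr_gt0.
exists (b1 * ell * C)^-1; first by rewrite invr_gt0.
move=> h N tau g0 g1 U U' Us h0 NhE tau0 balU balUs Ub Usb Uss.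
have := contraction_step h alpha N mu beta B tau g0 g1 U U' Us h0 tau0 Bb balU balUs.
set E := mass _ _ (fun i => _ (U i)); set E' := mass _ _ _; set D := _ + alpha * _.
have slopeB i : slope h (fun i => U i - Us i) i = slope h U i - slope h Us i.
  by rewrite /slope; ring.
have WD i : (i <= N)%N -> (U i - Us i) ^+ 2 <= C * D.
  apply: (HC h N (fun i => U i - Us i) (fun j => (mu (slope h U j) - mu (slope h Us j))
                             * (slope h U j - slope h Us j))) => // j jN.
  - move: (Ub j jN) (Usb j jN) => /andP[? ?] /andP[? ?].
    by rewrite ler_norml; apply/andP; split; lra.
  - exact: mono_mul_ge0.
  - by rewrite slopeB Uss//; exact: (smu _).1.
  - by rewrite slopeB Uss//; exact: (smu _).2.
have ED : E <= b1 * ell * C * D.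
  have -> : b1 * ell * C * D = mass h N (fun=> b1 * (C * D)).
    by rewrite mass_cst NhE; ring.
  apply: mass_le => // i iN.
  have /andP[_] := bregman_bounds _ _ _ _ _ _ _ _ Bb bb (Usb i iN) (Ub i iN).
  by move=> /le_trans; apply; rewrite ler_pM2l// WD.
apply: le_trans; rewrite mulrDl mul1r lerD2l -mulrA mulrCA ler_pM2l//.
by rewrite mulrC ler_pdivrMr// mulrC.
Qed.

(** With [y = c * tau / (1 + c * tau)], each step contributes the factor [1 - y <= expR (- y)]. The
    bound [tau <= T] makes the rate uniform: one long step gains only an algebraic factor in
    [tau]. *)
Lemma geometric_decay {R : realType} (c T tau : R) (e : nat -> R) (j k : nat) :
  0 < c -> 0 < tau <= T -> (forall n, 0 <= e n) -> (j <= k)%N ->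
  (forall n, (j <= n < k)%N -> (1 + c * tau) * e n.+1 <= e n) ->
  e k <= expR (- (c / (1 + c * T)) * (k%:R * tau - j%:R * tau)) * e j.
Proof.
move=> c0 /andP[tau0 tauT] e0 jk step.
elim: k jk step => [|k IH] jk step.
  by move: jk; rewrite leqn0 => /eqP ->; rewrite subrr mulr0 expR0 mul1r.
move: jk; rewrite leq_eqVlt => /predU1P[->|jk].
  by rewrite subrr mulr0 expR0 mul1r.
have ct0 : 0 < c * tau by exact: mulr_gt0.
have cT0 : 0 < 1 + c * T by rewrite addr_gt0// mulr_gt0// (lt_le_trans tau0).
have c1 : 0 < 1 + c * tau by rewrite addr_gt0.
have Hs : (1 + c * tau) * e k.+1 <= e k by apply: step; rewrite -ltnS jk /=.
have {}IH : e k <= expR (- (c / (1 + c * T)) * (k%:R * tau - j%:R * tau)) * e j.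
  by apply: IH => // n /andP[jn nk]; apply: step; rewrite jn/= ltnS ltnW.
have -> : - (c / (1 + c * T)) * (k.+1%:R * tau - j%:R * tau) =
   - (c / (1 + c * T)) * tau + - (c / (1 + c * T)) * (k%:R * tau - j%:R * tau).
  by rewrite -natr1; ring.
rewrite expRD -mulrA; apply: (@le_trans _ _ ((1 + c * tau)^-1 * e k)).
  by rewrite mulrC ler_pdivlMr// mulrC.
apply: ler_pM => //; first by rewrite invr_ge0 ltW.
apply: (@le_trans _ _ (expR (- (c * tau / (1 + c * tau))))).
  apply: le_trans (expR_ge1Dx _).
  by rewrite le_eqVlt; apply/orP; left; apply/eqP; field; rewrite gt_eqF.
rewrite ler_expR mulNr lerN2 mulrAC ler_pM2l// lef_pV2 ?posrE//.
by rewrite lerD2l ler_pM2l.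
Qed.

(** * Constitutive functions *)

Section ContinuousIntegral.
Context {R : realType}.
Variable f : R -> R.
Notation leb := (@lebesgue_measure R).

Lemma within_integrable (a b : R) :
  {within `[a, b], continuous f} -> leb.-integrable `[a, b] (EFin \o f).
Proof.
by move=> cf; apply: continuous_compact_integrable => //; exact: segment_compact.
Qed.

Lemma Rintegral_itv_cst (a b c : R) : a <= b ->
  \int[leb]_(x in `[a, b]) c = c * (b - a).
Proof.
move=> ab; rewrite Rintegral_cst//= lebesgue_measure_itv/= lte_fin.
by move: ab; rewrite le_eqVlt => /predU1P[->|->]; rewrite ?ltxx ?subrr.
Qed.

Lemma Rintegral_chasles (a c b : R) : a <= c -> c <= b ->
  {within `[a, b], continuous f} ->
  \int[leb]_(x in `[a, b]) f x =
  \int[leb]_(x in `[a, c]) f x + \int[leb]_(x in `[c, b]) f x.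
Proof.
move=> ac cb cf; have iab := within_integrable _ _ cf.
apply/eqP; rewrite addrC -subr_eq; apply/eqP.
rewrite Rintegral_itvB//= ?bnd_simp// Rintegral_itv_obnd_cbnd//.
apply: integrableS iab => //; apply: subset_itvr; rewrite bnd_simp//.
Qed.

End ContinuousIntegral.

Section Primitive.
Context {R : realType}.
Variable f : R -> R.
Notation leb := (@lebesgue_measure R).

Lemma primitive0B (x y : R) : continuous f -> x <= y ->
  primitive0 f y - primitive0 f x = \int[leb]_(t in `[x, y]) f t.
Proof.
move=> cf xy; have cfw A : {within A, continuous f} by exact: continuous_subspaceT.
rewrite /primitive0; case: (leP 0 y) => y0; case: (leP 0 x) => x0.
- by rewrite (Rintegral_chasles f 0 x y)//; lra.
- by rewrite (Rintegral_chasles f x 0 y)//; [lra|exact: ltW].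
- by lra.
- by rewrite (Rintegral_chasles f x y 0)//; [lra|exact: ltW].
Qed.

(** The integral of [f] between [x] and [y] is compared with that of the constant [f x]; for [y < x]
    both the comparison and the orientation flip. *)
Lemma subgradient_primitive0 : continuous f -> {homo f : x y / x <= y} ->
  subgradient (primitive0 f) f.
Proof.
move=> cf nf x y; have cfw A : {within A, continuous f} by exact: continuous_subspaceT.
have icst a b (c : R) : leb.-integrable `[a, b] (EFin \o fun=> c).
  by apply: within_integrable; apply: continuous_subspaceT; exact: cst_continuous.
have [xy|/ltW yx] := leP x y.
  rewrite -lerBrDl primitive0B// -Rintegral_itv_cst//.
  apply: le_Rintegral => //; [exact: within_integrable|].
  by move=> t /=; rewrite in_itv/= => /andP[xt _]; exact: nf.
rewrite -opprB mulrN -lerBrDl lerNl opprB primitive0B// -Rintegral_itv_cst//.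
apply: le_Rintegral => //; [exact: within_integrable|].
by move=> t /=; rewrite in_itv/= => /andP[_ xt]; exact: nf.
Qed.

Lemma primitive00 : primitive0 f 0 = 0.
Proof. by rewrite /primitive0 lexx set_itv1 Rintegral_set1. Qed.

End Primitive.

Section Constitutive.
Context {R : realType}.
Variable f : R -> R.
Hypothesis hf : constitutive f.

(** Only the open interval has to avoid 0, since continuity is enough at the end points; intervals
    touching 0 are thus covered. *)
Lemma constitutive_MVT (a b : R) : a < b -> (forall x, a < x < b -> x != 0) ->
  exists2 c, a < c < b & f b - f a = derive1 f c * (b - a).
Proof.
move=> ab ab0; case: hf => cf df.
have [] := @MVT R f (derive1 f) a b ab; last by move=> c; rewrite in_itv; exists c.
- move=> x; rewrite in_itv/= => /ab0 /df[dfx _ _]; rewrite derive1E.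
  exact/derivableP.
- exact: continuous_subspaceT.
Qed.

Lemma constitutive_incr : {homo f : x y / x < y}.
Proof.
have pos a b : a < b -> (forall x, a < x < b -> x != 0) -> f a < f b.
  move=> ab ab0; have [c cab E] := constitutive_MVT a b ab ab0.
  by rewrite -subr_gt0 E mulr_gt0 ?subr_gt0//; have [] := hf.2 c (ab0 c cab).
move=> x y xy; have [x0|x0] := leP 0 x.
  by apply: pos => // z /andP[xz _]; rewrite gt_eqF// (le_lt_trans x0).
have [y0|y0] := leP y 0.
  by apply: pos => // z /andP[_ zy]; rewrite lt_eqF// (lt_le_trans zy).
apply: (@lt_trans _ _ (f 0)); apply: pos => // z /andP[? ?].
- by rewrite lt_eqF.
- by rewrite gt_eqF.
Qed.

(** The constants are the extreme values of the derivative, which is continuous and positive on this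
    compact interval. *)
Lemma constitutive_bilipschitz (lo up : R) : lo <= up ->
  (forall x, lo <= x <= up -> x != 0) ->
  exists b0 b1, [/\ 0 < b0, 0 < b1 & bilipschitz_on lo up b0 b1 f].
Proof.
move=> loup n0; case: (hf) => cf df.
have cdf : {within `[lo, up], continuous (derive1 f)}.
  apply: continuous_in_subspaceT => x; rewrite inE/= in_itv/= => /n0 /df[_ + _].
  exact.
have [c0 + Hc0] := EVT_min loup cdf; rewrite in_itv/= => c0i.
have [c1 + Hc1] := EVT_max loup cdf; rewrite in_itv/= => c1i.
exists (derive1 f c0), (derive1 f c1); split.
- by have [] := df _ (n0 _ c0i).
- by have [] := df _ (n0 _ c1i).
have key x y : lo <= x <= up -> lo <= y <= up -> x < y ->
    derive1 f c0 * (y - x) ^+ 2 <= (f y - f x) * (y - x)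
      <= derive1 f c1 * (y - x) ^+ 2.
  move=> /andP[lox _] /andP[_ yup] xy.
  have inn z : x < z < y -> z \in `[lo, up].
    move=> /andP[xz zy]; rewrite in_itv/= (le_trans lox (ltW xz))/=.
    by rewrite (le_trans (ltW zy)).
  have [c cxy ->] := constitutive_MVT x y xy (fun z H => n0 z (inn z H)).
  rewrite -mulrA -expr2 !ler_pM2r ?exprn_gt0 ?subr_gt0//.
  by rewrite Hc0 ?Hc1//; exact: inn.
move=> x y xi yi; have [xy|yx|->] := ltgtP x y; last first.
- by rewrite !subrr !expr0n/= !mulr0 lexx.
- exact: key.
- by have := key _ _ xi yi xy; rewrite -sqrrN opprB -[f y - _]opprB -[y - x]opprB mulrNN.
Qed.

End Constitutive.

(** At [s + d] and [s - d] the local bound makes the increment of [f] at least [m * d] in absolute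
    value; monotonicity keeps it so farther out. *)
Lemma strongly_increasing_of_near {R : realType} (f : R -> R) (m d s : R) :
  {homo f : x y / x < y} -> 0 < m -> 0 < d ->
  (forall x, `|x - s| <= d -> m * (x - s) ^+ 2 <= (f x - f s) * (x - s)) ->
  strongly_increasing_at m d f s.
Proof.
move=> fi m0 d0 H x; split; first exact: H.
have fle : {homo f : x y / x <= y}.
  by move=> a b; rewrite le_eqVlt => /predU1P[->//|/fi/ltW].
have Hp := H (s + d); have Hm := H (s - d).
have := Hp; rewrite addrC addKr (gtr0_norm d0) lexx => /(_ isT).
rewrite expr2 mulrA ler_pM2r// => {}Hp.
have := Hm; rewrite addrC addKr normrN (gtr0_norm d0) lexx => /(_ isT).
rewrite sqrrN mulrN -mulNr expr2 mulrA ler_pM2r// => {}Hm.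
have [sx|xs] := leP s x.
  rewrite ger0_norm ?subr_ge0// => dx; apply: ler_wpM2r; first by rewrite subr_ge0.
  by apply: le_trans Hp _; rewrite lerD2r; apply: fle; lra.
rewrite ltr0_norm ?subr_lt0// => dx; rewrite -[leRHS]mulrNN; apply: ler_wpM2r.
  by lra.
by apply: le_trans Hm _; rewrite lerN2 lerD2r; apply: fle; lra.
Qed.

(** Half of the distance from [s] to 0 is a radius on which the derivative stays away from its
    possible singularity. *)
Lemma constitutive_strongly_increasing {R : realType} (f : R -> R) (s : R) :
  constitutive f -> s != 0 ->
  exists m d, [/\ 0 < m, 0 < d & strongly_increasing_at m d f s].
Proof.
move=> hf s0; have d0 : 0 < `|s| / 2 by rewrite divr_gt0// normr_gt0.
have [] := constitutive_bilipschitz f hf (s - `|s| / 2) (s + `|s| / 2).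
- by lra.
- move=> x /andP[x1 x2]; apply/negP => /eqP x0; move: x1 x2; rewrite {}x0.
  by have [sp|sn|E] := ltgtP 0 s; [rewrite gtr0_norm//; lra|rewrite ltr0_norm//; lra|
    rewrite -E eqxx in s0].
move=> m [b1 [m0 _ b]]; exists m, (`|s| / 2); split => //.
apply: strongly_increasing_of_near => //; first exact: constitutive_incr.
move=> x; rewrite ler_norml => /andP[x1 x2].
by have /andP[] := b x s ltac:(lra) ltac:(lra).
Qed.

(** * Piecewise affine functions *)

Lemma integrable_disjU d (T : measurableType d) (R : realType)
    (mu : {measure set T -> \bar R}) (A B : set T) (f : T -> \bar R) :
  measurable A -> measurable B -> [disjoint A & B] ->
  mu.-integrable A f -> mu.-integrable B f -> mu.-integrable (A `|` B) f.
Proof.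
move=> mA mB AB /integrableP[mfA iA] /integrableP[mfB iB].
have mf := (measurable_funU _ mA mB).2 (conj mfA mfB).
apply/integrableP; split => //; rewrite ge0_integral_setU//.
  exact: lte_add_pinfty.
exact: measurableT_comp.
Qed.

Section Cells.
Context {R : realType}.
Notation leb := (@lebesgue_measure R).

Lemma integrable_open_itv (a b : R) (F p : R -> R) :
  {within `[a, b], continuous p} -> (forall x, a < x < b -> F x = p x) ->
  leb.-integrable `]a, b[ (EFin \o F).
Proof.
move=> cp Fp; have ip : leb.-integrable `]a, b[ (EFin \o p).
  by apply: integrableS (within_integrable _ _ _ cp) => //; exact: subset_itv_oo_cc.
apply: eq_integrable ip => // x.
by rewrite inE/= in_itv/= => H; rewrite Fp.
Qed.

Lemma Rintegral_open_itv (a b : R) (F p : R -> R) : a < b ->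
  {within `[a, b], continuous p} -> (forall x, a < x < b -> F x = p x) ->
  \int[leb]_(x in `]a, b[) F x = \int[leb]_(x in `[a, b]) p x.
Proof.
move=> ab cp Fp; have ip := within_integrable _ _ _ cp.
rewrite (@eq_Rintegral _ _ _ leb _ p); last first.
  by move=> x; rewrite inE/= in_itv/= => H; rewrite Fp.
rewrite Rintegral_itv_bndo_bndc; last first.
  by apply: integrableS ip => //; exact: subset_itv_oo_cc.
rewrite Rintegral_itv_obnd_cbnd//.
by apply: integrableS ip => //; exact: subset_itv_oc_cc.
Qed.

Lemma integrable_set1 (a : R) (F : R -> R) : leb.-integrable [set a] (EFin \o F).
Proof.
have ic : leb.-integrable [set a] (EFin \o fun=> F a).
  rewrite -set_itv1; apply: within_integrable.
  by apply: continuous_subspaceT; exact: cst_continuous.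
by apply: eq_integrable ic => // x; rewrite inE/= => ->.
Qed.

(** [F] is prescribed only inside the cells, because [derive1] has no meaning at the nodes; [p i] is
    its continuous extension to the closed cell. Each induction step adds an open cell and its right
    end point. *)
Lemma integral_cells (h : R) (F : R -> R) (p : nat -> R -> R) (n : nat) : 0 < h ->
  (forall i, (i < n)%N -> {within `[i%:R * h, i.+1%:R * h], continuous (p i)}) ->
  (forall i, (i < n)%N -> forall x, i%:R * h < x < i.+1%:R * h -> F x = p i x) ->
  leb.-integrable `[0, n%:R * h] (EFin \o F) /\
  \int[leb]_(x in `[0, n%:R * h]) F x =
  \sum_(i < n) \int[leb]_(x in `[i%:R * h, i.+1%:R * h]) p i x.
Proof.
move=> h0; elim: n => [|n IH] cp Fp.
  rewrite mul0r set_itv1 big_ord0 Rintegral_set1; split => //.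
  exact: integrable_set1.
have [iF IE] := IH (fun i H => cp i (ltnW H)) (fun i H => Fp i (ltnW H)).
have nh : n%:R * h < n.+1%:R * h by rewrite ltr_pM2r// ltr_nat.
have n0 : 0 <= n%:R * h by rewrite mulr_ge0 ?ler0n ?ltW.
set a := n%:R * h; set b := n.+1%:R * h.
have io := integrable_open_itv a b F (p n) (cp n (ltnSn n)) (Fp n (ltnSn n)).
have Io := Rintegral_open_itv a b F (p n) nh (cp n (ltnSn n)) (Fp n (ltnSn n)).
have E1 : `]a, b]%classic = `]a, b[ `|` [set b] :> set R by rewrite setUitv1//= bnd_simp.
have E2 : `[0, b]%classic = `[0, a] `|` `]a, b] :> set R.
  by rewrite -itv_bndbnd_setU//= bnd_simp// ltW.
have d1 : [disjoint `]a, b[%classic & [set b]].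
  by apply/disj_setPS => y [/=]; rewrite in_itv/= => /andP[_ +] E; rewrite E ltxx.
have d2 : [disjoint `[0, a]%classic & `]a, b]%classic].
  by apply/disj_setPS => y [/=]; rewrite !in_itv/= => /andP[_ +] /andP[+ _]; case: ltgtP.
have i1 : leb.-integrable `]a, b] (EFin \o F).
  by rewrite E1; apply: integrable_disjU => //; exact: integrable_set1.
have i2 : leb.-integrable `[0, b] (EFin \o F).
  by rewrite E2; exact: integrable_disjU.
split => //; rewrite E2 Rintegral_setU -?E2//.
rewrite IE big_ord_recr/= -Io; congr (_ + _).
by rewrite E1 Rintegral_setU -?E1// Rintegral_set1 addr0.
Qed.

Lemma Rintegral_FTC2 (f F : R -> R) (a b : R) : a < b -> continuous f ->
  (forall x : R, is_derive x 1 F (f x)) ->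
  \int[leb]_(x in `[a, b]) f x = F b - F a.
Proof.
move=> ab cf dF; have dfF x : derivable F x 1 by have [] := dF x.
have cF : continuous F.
  by move=> x; apply/differentiable_continuous/derivable1_diffP.
rewrite /Rintegral (continuous_FTC2 ab (F := F))//.
- exact: continuous_subspaceT.
- split; first by move=> x _.
  + by apply: cvg_at_right_filter; exact: cF.
  + by apply: cvg_at_left_filter; exact: cF.
- by move=> x _; rewrite derive1E; apply: derive_val.
Qed.

Lemma Rintegral_affineM (a b p0 p1 q0 q1 : R) : a < b ->
  \int[leb]_(x in `[a, b]) ((p0 + p1 * (x - a)) * (q0 + q1 * (x - a))) =
  (b - a) * (p0 * q0) + (b - a) ^+ 2 / 2 * (p0 * q1 + p1 * q0)
  + (b - a) ^+ 3 / 3 * (p1 * q1).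
Proof.
move=> ab.
pose P : {poly R} := (p0 * q0)%:P * ('X - a%:P)
  + ((p0 * q1 + p1 * q0) / 2)%:P * ('X - a%:P) ^+ 2 + (p1 * q1 / 3)%:P * ('X - a%:P) ^+ 3.
rewrite (@eq_Rintegral _ _ _ leb _ (horner P^`())); last first.
  move=> x _; rewrite /P !derivD !derivM !derivC ?deriv_exp !derivXsubC !hornerE/=.
  by field.
rewrite (Rintegral_FTC2 _ _ _ _ ab (@continuous_horner _ P^`()) (is_derive_poly P)).
by rewrite /P !hornerE/=; field.
Qed.

End Cells.

(** Stated for sequences, so that it also yields test functions; [Ih f] is convertible to it for
    [V = f \o node ell N]. *)
Definition interp {R : realType} (ell : R) (N : nat) (V : nat -> R) (x : R) : R :=
  \sum_(i < N.+1) V i * hat ell N i x.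

Lemma sum_ord_delta {R : realType} (n i : nat) (G : nat -> R) : (i < n)%N ->
  \sum_(j < n) G j * ((j : nat) == i)%:R = G i.
Proof.
move=> i_n; rewrite (bigD1 (Ordinal i_n))//= eqxx mulr1 big1 ?addr0// => j.
by rewrite -val_eqE/= => /negbTE ->; rewrite mulr0.
Qed.

(** * The integrals of the scheme in terms of nodal values *)

Section NodalReduction.
Context {R : realType}.
Variables (ell : R) (N : nat).
Notation leb := (@lebesgue_measure R).
Notation h := (ell / N%:R).
Notation xn := (node ell N).

Lemma mesh_gt0 : 0 < ell -> (0 < N)%N -> 0 < h.
Proof. by move=> ell0 N0; rewrite divr_gt0// ltr0n. Qed.

Lemma meshE : (0 < N)%N -> N%:R * h = ell.
Proof. by move=> N0; rewrite mulrC divfK// pnatr_eq0 -lt0n. Qed.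

Lemma node0 : xn 0%N = 0. Proof. by rewrite /node mul0r. Qed.

Lemma nodeN : (0 < N)%N -> xn N = ell. Proof. exact: meshE. Qed.

Lemma nodeS i : xn i.+1 = xn i + h.
Proof. by rewrite /node -natr1 mulrDl mul1r. Qed.

Lemma node_le i j : 0 < h -> (i <= j)%N -> xn i <= xn j.
Proof. by move=> h0 ij; rewrite /node ler_pM2r// ler_nat. Qed.

Lemma node_in i : 0 < ell -> (0 < N)%N -> (i <= N)%N -> 0 <= xn i <= ell.
Proof.
move=> ell0 N0 iN; have h0 := mesh_gt0 ell0 N0.
by rewrite -[X in _ <= _ <= X]nodeN// -{1}node0 !node_le.
Qed.

Lemma Vh_cell v i x : 0 < h -> Vh ell N v -> (i < N)%N -> xn i <= x <= xn i.+1 ->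
  v x = v (xn i) + slope h (v \o xn) i * (x - xn i).
Proof.
move=> h0 [_ /(_ i) va] iN xi; have [a [b vE]] : exists a b : R, forall x, x \in `[xn i, xn i.+1] -> v x = a * x + b := va iN.
have xx : xn i <= xn i.+1 by exact: node_le.
have hn0 : h != 0 by rewrite gt_eqF.
have vi := vE (xn i); rewrite in_itv/= lexx xx in vi; rewrite vi//.
have vi1 := vE (xn i.+1); rewrite in_itv/= lexx xx in vi1.
have -> : slope h (v \o xn) i = a.
  by rewrite /slope/= vi// vi1// nodeS opprD addrACA subrr addr0 -mulrBr addrC addKr mulfK.
by rewrite vE ?in_itv//; ring.
Qed.

Lemma Vh_derive1 v i x : 0 < h -> Vh ell N v -> (i < N)%N -> xn i < x < xn i.+1 ->
  derive1 v x = slope h (v \o xn) i.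
Proof.
move=> h0 vV iN xi; rewrite derive1E.
set s := slope _ _ _; pose c := v (xn i) - s * xn i.
rewrite (@near_eq_derive _ _ _ _ (horner (c%:P + s%:P * 'X))).
  rewrite derive_val.
  by rewrite !(derivD, derivM, derivC, derivX) !hornerE; ring.
have := @near_in_itvoo R (xn i) (xn i.+1) x; rewrite in_itv/= => /(_ xi).
apply: filterS => y; rewrite in_itv/= => /andP[y1 y2].
by rewrite (Vh_cell _ _ _ h0 vV iN) ?(ltW y1) ?(ltW y2)// !hornerE/= -/s /c; ring.
Qed.

Lemma hatE i j x : 0 < h -> xn i <= x <= xn i.+1 ->
  hat ell N j x = (j == i)%:R * (1 - (x - xn i) / h) + (j == i.+1)%:R * ((x - xn i) / h).
Proof.
move=> h0 /andP[xi]; rewrite nodeS => xi1.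
have t0 : 0 <= (x - xn i) / h by rewrite divr_ge0 ?(ltW h0)// subr_ge0.
have t1 : (x - xn i) / h <= 1 by rewrite ler_pdivrMr// mul1r lerBlDl.
rewrite /hat; have [ji|ij|->] := ltngtP j i.
- rewrite mul0r add0r ltn_eqF ?mul0r; last exact: ltnW.
  apply/max_idPl; rewrite subr_le0 ler_pdivlMr// mul1r ger0_norm.
    by have := node_le _ _ h0 ji; rewrite nodeS; lra.
  by rewrite subr_ge0 (le_trans _ xi)// node_le// ltnW.
- move: ij; rewrite leq_eqVlt => /predU1P[<-|ij]; last first.
    rewrite mul0r add0r gtn_eqF// mul0r.
    have := node_le _ _ h0 ij; rewrite !nodeS => H.
    apply/max_idPl; rewrite subr_le0 ler_pdivlMr// mul1r distrC ger0_norm; lra.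
  rewrite eqxx mul0r add0r mul1r nodeS distrC ger0_norm; last lra.
  have -> : 1 - (xn i + h - x) / h = (x - xn i) / h.
    by rewrite -{1}(divff (lt0r_neq0 h0)) -mulrBl; congr (_ / _); ring.
  exact/max_idPr.
- rewrite mul1r ltn_eqF// mul0r addr0 ger0_norm ?subr_ge0//.
  by apply/max_idPr; rewrite subr_ge0.
Qed.

Lemma interpE V i x : 0 < h -> (i < N)%N -> xn i <= x <= xn i.+1 ->
  interp ell N V x = V i * (1 - (x - xn i) / h) + V i.+1 * ((x - xn i) / h).
Proof.
move=> h0 iN xi; rewrite /interp.
set t := (x - xn i) / h.
transitivity (\sum_(j < N.+1) (V j * ((j : nat) == i)%:R * (1 - t)
                               + V j * ((j : nat) == i.+1)%:R * t)).
  by apply: eq_bigr => j _; rewrite (hatE _ _ _ h0 xi) -/t mulrDr !mulrA.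
by rewrite big_split/= -!mulr_suml !sum_ord_delta// ltnS ltnW.
Qed.

Lemma interp_node V i : 0 < h -> (0 < N)%N -> (i <= N)%N -> interp ell N V (xn i) = V i.
Proof.
move=> h0 N0; rewrite leq_eqVlt => /predU1P[->|iN]; last first.
  by rewrite (interpE _ i)// ?lexx ?node_le// subrr mul0r subr0 mulr1 mulr0 addr0.
(* The last node is not the left end of any cell; it is reached as the right end of cell [N.-1]. *)
have pN : (N.-1 < N)%N by rewrite prednK.
rewrite (interpE _ N.-1)// prednK// ?lexx ?node_le ?leq_pred//.
have -> : xn N - xn N.-1 = h.
  by have := nodeS N.-1; rewrite prednK// => ->; rewrite addrC addKr.
by rewrite divff ?lt0r_neq0// subrr mulr0 add0r mulr1.
Qed.

Lemma hat_continuous i : continuous (hat ell N i).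
Proof.
move=> x; apply: (@continuous_max _ _ (cst 0) (fun y => 1 - `|y - xn i| / h)).
  exact: cst_continuous.
apply: continuousB; first exact: cst_continuous.
apply: continuousM; last exact: cst_continuous.
apply: continuous_comp; last exact: norm_continuous.
by apply: continuousB; [exact: id|exact: cst_continuous].
Qed.

Lemma interp_continuous V : continuous (interp ell N V).
Proof.
apply: continuous_big => [|i _ x]; first exact: add_continuous.
by apply: continuousM; [exact: cst_continuous|exact: hat_continuous].
Qed.

Lemma Vh_interp V : 0 < h -> Vh ell N (interp ell N V).
Proof.
move=> h0; split; first exact/continuous_subspaceT/interp_continuous.
move=> i iN; exists ((V i.+1 - V i) / h), (V i - (V i.+1 - V i) / h * xn i).
by move=> x; rewrite in_itv/= => /(interpE V _ _ h0 iN) ->; ring.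
Qed.

Lemma VhB u v : Vh ell N u -> Vh ell N v -> Vh ell N (u \- v).
Proof.
move=> [cu au] [cv av]; split; first by move=> x; apply: continuousB; [exact: cu|exact: cv].
move=> i iN; have [a [b ub]] : exists a b : R, forall x, x \in `[xn i, xn i.+1] -> u x = a * x + b := au i iN.
have [c [d vd]] : exists c d : R, forall x, x \in `[xn i, xn i.+1] -> v x = c * x + d := av i iN.
by exists (a - c), (b - d) => x xi /=; rewrite ub// vd//; ring.
Qed.

Lemma affineM_continuous (a p0 p1 q0 q1 : R) :
  continuous (fun x : R => (p0 + p1 * (x - a)) * (q0 + q1 * (x - a)) : R).
Proof.
move=> x; have H p q : {for x, continuous (fun x : R => p + q * (x - a))}.
  apply: cvgD; first exact: cvg_cst.
  apply: cvgM; first exact: cvg_cst.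
  by apply: cvgB; [exact: cvg_id|exact: cvg_cst].
exact: (cvgM (H _ _) (H _ _)).
Qed.

(** All integrals of the scheme have this form on each cell: constant times constant for the flux,
    affine times 1 for the lumped product, affine times affine for the L^2 norm. *)
Lemma integral_nodes F (p0 p1 q0 q1 : nat -> R) : 0 < ell -> (0 < N)%N ->
  (forall i, (i < N)%N -> forall x, xn i < x < xn i.+1 ->
     F x = (p0 i + p1 i * (x - xn i)) * (q0 i + q1 i * (x - xn i))) ->
  \int[leb]_(x in `[0, ell]) F x =
  \sum_(i < N) (h * (p0 i * q0 i) + h ^+ 2 / 2 * (p0 i * q1 i + p1 i * q0 i)
                + h ^+ 3 / 3 * (p1 i * q1 i)).
Proof.
move=> ell0 N0 FE; have h0 := mesh_gt0 ell0 N0.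
have [|_] := integral_cells h F (fun i x => (p0 i + p1 i * (x - xn i)) * (q0 i + q1 i * (x - xn i))) N h0 _ FE.
  by move=> i iN; exact/continuous_subspaceT/affineM_continuous.
rewrite meshE// => ->; apply: eq_bigr => i _.
rewrite Rintegral_affineM ?ltr_pM2r ?ltr_nat//.
by have -> : i.+1%:R * h - i%:R * h = h by rewrite -natr1; ring.
Qed.

Lemma inner_mu_nodal (mu : R -> R) u v : 0 < ell -> (0 < N)%N ->
  Vh ell N u -> Vh ell N v ->
  inner ell (mu \o derive1 u) (derive1 v) =
  \sum_(i < N) h * (mu (slope h (u \o xn) i) * slope h (v \o xn) i).
Proof.
move=> ell0 N0 uV vV; have h0 := mesh_gt0 ell0 N0.
rewrite /inner (integral_nodes _ (fun i => mu (slope h (u \o xn) i)) (fun=> 0)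
   (slope h (v \o xn)) (fun=> 0))//; first by apply: eq_bigr => i _; ring.
move=> i iN x xi /=; rewrite (Vh_derive1 u i)// (Vh_derive1 v i)//; ring.
Qed.

Lemma inner_h_nodal f v : 0 < ell -> (0 < N)%N ->
  inner_h ell N f v = mass h N (fun i => f (xn i) * v (xn i)).
Proof.
move=> ell0 N0; have h0 := mesh_gt0 ell0 N0.
rewrite /inner_h (integral_nodes _ (fun i => f (xn i) * v (xn i))
   (slope h (fun i => f (xn i) * v (xn i))) (fun=> 1) (fun=> 0))//.
  by apply: eq_bigr => i _; rewrite /slope; field; rewrite ?gt_eqF// ?ltr0n//.
move=> i iN x /andP[/ltW x1 /ltW x2].
rewrite -[LHS]/(interp ell N (fun i => f (xn i) * v (xn i)) x) (interpE _ i) ?x1//.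
by rewrite /slope; ring.
Qed.

(** With end values [a] and [b], the exact integral over a cell is [h / 3 * (a^2 + a b + b^2)]. The
    gaps in the two inequalities are [h / 6 * (a - b)^2] and [h / 2 * (a + b)^2]. *)
Lemma inner_sqr_bounds v : 0 < ell -> (0 < N)%N -> Vh ell N v ->
  inner ell v v <= mass h N (fun i => v (xn i) ^+ 2) <= 3 * inner ell v v.
Proof.
move=> ell0 N0 vV; have h0 := mesh_gt0 ell0 N0.
rewrite /inner (integral_nodes _ (v \o xn) (slope h (v \o xn))
   (v \o xn) (slope h (v \o xn)))//; last first.
  by move=> i iN x /andP[/ltW x1 /ltW x2]; rewrite (Vh_cell v i) ?x1.
have E i : h * ((v \o xn) i * (v \o xn) i)
   + h ^+ 2 / 2 * ((v \o xn) i * slope h (v \o xn) i + slope h (v \o xn) i * (v \o xn) i)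
   + h ^+ 3 / 3 * (slope h (v \o xn) i * slope h (v \o xn) i)
  = h / 3 * (v (xn i) ^+ 2 + v (xn i) * v (xn i.+1) + v (xn i.+1) ^+ 2).
  by rewrite /slope/=; field; rewrite ?gt_eqF// ?ltr0n//.
under eq_bigr do rewrite E; rewrite /mass mulr_sumr.
by apply/andP; split; apply: ler_sum => i _;
  [have := mulr_ge0 (ltW h0) (sqr_ge0 (v (xn i) - v (xn i.+1)))|
   have := mulr_ge0 (ltW h0) (sqr_ge0 (v (xn i) + v (xn i.+1)))]; rewrite !expr2; lra.
Qed.

End NodalReduction.

(** * Weak derivatives *)

Section Bump.
Context {R : realType}.
Notation leb := (@lebesgue_measure R).

Lemma max0_continuous (c : R) : continuous (fun x : R => Num.max 0 (x - c)).
Proof.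
move=> x; apply: (@continuous_max _ _ (cst 0) (fun y => y - c)).
  exact: cst_continuous.
by apply: cvgB; [exact: cvg_id|exact: cvg_cst].
Qed.

(** The function is the squared positive part of [y - c], the C^1 building block of the cut-offs. *)
Lemma is_derive_sqr_pos (c x : R) :
  is_derive x 1 (fun y : R => (y - c) * Num.max 0 (y - c)) (2 * Num.max 0 (x - c)).
Proof.
have [xc|cx|->] := ltgtP x c.
- have -> : Num.max 0 (x - c) = 0 by apply/max_idPl; lra.
  rewrite mulr0; apply: (near_eq_is_derive _ (is_derive_cst (0 : R) x (1 : R))).
  have := @near_in_itvNyo R c x; rewrite in_itv/= => /(_ xc).
  apply: filterS => y; rewrite in_itv/= => yc.
  by have -> : Num.max 0 (y - c) = 0 by [apply/max_idPl; lra]; rewrite mulr0.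
- have -> : Num.max 0 (x - c) = x - c by apply/max_idPr; lra.
  pose p : {poly R} := ('X - c%:P) * ('X - c%:P).
  have -> : 2 * (x - c) = p^`().[x].
    by rewrite /p !(derivM, derivXsubC) mul1r mulr1 hornerD hornerXsubC; ring.
  apply: near_eq_is_derive (is_derive_poly p x).
  have := @near_in_itvoy R c x; rewrite in_itv/= andbT => /(_ cx).
  apply: filterS => y; rewrite in_itv/= andbT => yc; rewrite /p !hornerE.
  by have -> : Num.max 0 (y - c) = y - c by apply/max_idPr; lra.
(* At the kink the difference quotient is [Num.max 0 h], which tends to 0. *)
- rewrite subrr maxxx mulr0.
  have H : (fun h : R => h^-1 *: ((h *: 1 + c - c) * Num.max 0 (h *: 1 + c - c)
     - (c - c) * Num.max 0 (c - c))) @ 0^' --> (0 : R).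
    have cm : (fun h : R => Num.max 0 (h - 0)) @ 0^' --> (0 : R).
      apply: cvg_within_filter; have := max0_continuous 0 0.
      by rewrite /continuous_at subr0 maxxx.
    apply: cvg_trans cm; apply: near_eq_cvg; near=> h.
    have h0 : h != 0 by near: h; exact: nbhs_dnbhs_neq.
    by rewrite addrK subrr mul0r !subr0 /GRing.scale/= mulr1 mulrA mulVf// mul1r.
  apply: DeriveDef; first by apply: cvgP; exact: H.
  exact: cvg_lim H.
Unshelve. all: end_near. Qed.

(** [r] is a scaled second difference of squared positive parts; its derivative is a tent on
    [[c, c + d]] of height [2 / d], hence of mass 1. *)
Lemma smooth_step (c d : R) : 0 < d ->
  exists r dr : R -> R,
  [/\ forall x : R, is_derive x 1 r (dr x), continuous dr,
      forall x, 0 <= dr x /\ 0 <= r x <= 1,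
      forall x, x <= c -> r x = 0 /\ dr x = 0 &
      forall x, c + d <= x -> r x = 1 /\ dr x = 0].
Proof.
move=> d0; pose s (c x : R) := (x - c) * Num.max 0 (x - c).
pose m (c x : R) := Num.max 0 (x - c).
have mE b x : b <= x -> m b x = x - b by move=> bx; apply/max_idPr; lra.
have m0 b x : x <= b -> m b x = 0 by move=> bx; apply/max_idPl; lra.
have k0 : 0 < 2 / d ^+ 2 by rewrite divr_gt0// exprn_gt0.
have dn0 : d != 0 by rewrite gt_eqF.
exists (fun x => 2 / d ^+ 2 * (s c x - 2 * s (c + d / 2) x + s (c + d) x)).
exists (fun x => 2 / d ^+ 2 * (2 * m c x - 4 * m (c + d / 2) x + 2 * m (c + d) x)).
split.
- move=> x; have h1 := is_derive_sqr_pos c x.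
  have h2 := is_derive_sqr_pos (c + d / 2) x.
  have h3 := is_derive_sqr_pos (c + d) x.
  have := is_deriveZ (2 / d ^+ 2) (is_deriveD (is_deriveB h1 (is_deriveZ 2 h2)) h3).
  by move=> /is_derive_eq; apply; rewrite /GRing.scale/= /m; ring.
- move=> x; apply: cvgM; first exact: cvg_cst.
  apply: cvgD; last by apply: cvgM; [exact: cvg_cst|exact: max0_continuous].
  by apply: cvgB; apply: cvgM; (exact: cvg_cst || exact: max0_continuous).
- move=> x; rewrite /s -!/(m _ _).
  have kE (X : R) : 2 / d ^+ 2 * X <= 1 = (X <= d ^+ 2 / 2).
    by rewrite mulrC mulrA ler_pdivrMr ?exprn_gt0// mul1r ler_pdivlMr.
  rewrite kE !pmulr_rge0//.
  have [xc|cx] := leP x c; first by rewrite !m0; lra || nra.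
  have [xd|dx] := leP x (c + d / 2).
    by rewrite (mE c) ?(ltW cx)// !m0; first (split; [|apply/andP; split]); nra.
  have [xe|ex] := leP x (c + d).
    rewrite (mE c) ?(ltW cx)// (mE (c + d / 2)) ?(ltW dx)// m0//.
    by split; [|apply/andP; split]; nra.
  rewrite (mE c) ?(ltW cx)// (mE (c + d / 2)) ?(ltW dx)// mE ?(ltW ex)//.
  by split; [|apply/andP; split]; nra.
- move=> x xc; rewrite /s -!/(m _ _) !m0//; [|lra|lra].
  by split; ring.
- move=> x xc; rewrite /s -!/(m _ _) !mE//; [|lra|lra].
  by split; field.
Qed.

Lemma within_continuous_le (A : set R) (f : R -> R) (x e : R) :
  {within A, continuous f} -> A x -> 0 < e ->
  exists2 d, 0 < d & forall y, A y -> `|x - y| < d -> `|f x - f y| <= e.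
Proof.
move=> /subspace_continuousP cf Ax e0; have /cvgrPdist_le/(_ e e0) := cf x Ax.
rewrite /within/= => /nbhs_ballP[d /= d0 H]; exists d => // y Ay xy.
exact: H.
Qed.

End Bump.

Section WeakDerivative.
Context {R : realType}.
Notation leb := (@lebesgue_measure R).

Lemma Rintegral_support (I J : set R) (F : R -> R) : J `<=` I ->
  (forall x, I x -> ~ J x -> F x = 0) ->
  \int[leb]_(x in I) F x = \int[leb]_(x in J) F x.
Proof.
move=> JI F0; rewrite -[in RHS](setIidr JI) Rintegral_mkcondr.
apply: eq_Rintegral => x; rewrite inE => Ix; rewrite /patch.
by case: ifPn => //; rewrite notin_setE; exact: F0.
Qed.

Lemma weighted_mean_le (a b A e : R) (f w : R -> R) :
  {within `[a, b], continuous f} -> {within `[a, b], continuous w} ->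
  \int[leb]_(x in `[a, b]) w x = 1 -> (forall x, 0 <= w x) ->
  (forall x, a <= x <= b -> w x != 0 -> `|A - f x| <= e) ->
  `|\int[leb]_(x in `[a, b]) (f x * w x) - A| <= e.
Proof.
move=> cf cw w1 w0 fA; have iw := within_integrable _ _ _ cw.
have iwf : leb.-integrable `[a, b] (EFin \o fun x => f x * w x).
  by apply: within_integrable => x; apply: cvgM; [exact: cf|exact: cw].
have icw c : leb.-integrable `[a, b] (EFin \o fun x => c * w x).
  by apply: within_integrable => x; apply: cvgM; [exact: cvg_cst|exact: cw].
have wE c : \int[leb]_(x in `[a, b]) (c * w x) = c.
  by rewrite RintegralZl// w1 mulr1.
rewrite ler_distl; apply/andP; split.
- rewrite -[X in X <= _]wE; apply: le_Rintegral => // x /=.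
  rewrite in_itv/= => xab; have [->|wx] := eqVneq (w x) 0; first by rewrite !mulr0.
  apply: ler_wpM2r => //; have := fA x xab wx; rewrite ler_distl => /andP[? ?]; lra.
- rewrite -[X in _ <= X]wE; apply: le_Rintegral => // x /=.
  rewrite in_itv/= => xab; have [->|wx] := eqVneq (w x) 0; first by rewrite !mulr0.
  apply: ler_wpM2r => //; have := fA x xab wx; rewrite ler_distl => /andP[? ?]; lra.
Qed.

(* Test functions approximating the indicator of [a, b] from inside. *)
Lemma weak_derivative_increment (I : set R) (f g : R -> R) (a b e : R) :
  a < b -> `]a, b[ `<=` I -> {within `[a, b], continuous f} ->
  weak_derivative I f g -> 0 < e ->
  exists (c d : R) (phi : R -> R), [/\ a < c /\ c < d /\ d < b, continuous phi,
    forall x, 0 <= phi x <= 1, leb.-integrable `[c, d] (EFin \o g) &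
    `|\int[leb]_(x in `[c, d]) (g x * phi x) - (f b - f a)| <= e].
Proof.
move=> ab abI cf [_ [mg oI ig] wd] e0.
have e20 : 0 < e / 2 by rewrite divr_gt0.
have aab : `[a, b]%classic a by rewrite /= in_itv/= lexx ltW.
have bab : `[a, b]%classic b by rewrite /= in_itv/= lexx ltW.
have [da da0 Ha] := within_continuous_le _ _ _ _ cf aab e20.
have [db db0 Hb] := within_continuous_le _ _ _ _ cf bab e20.
(* The quarter leaves room for both transitions: [r1] rises on [[a + dd, a + 2 * dd]] and [r2] on
   [[b - 2 * dd, b - dd]], close enough to [a] and [b] and without overlap. *)
pose dd := Num.min (Num.min da db) (b - a) / 4.
have m0 : 0 < Num.min (Num.min da db) (b - a) by rewrite !lt_min da0 db0 subr_gt0.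
have dd0 : 0 < dd by rewrite divr_gt0.
have dE : 4 * dd = Num.min (Num.min da db) (b - a) by rewrite /dd; field.
have [dda [ddb ddab]] : 4 * dd <= da /\ 4 * dd <= db /\ 4 * dd <= b - a.
  by rewrite dE !ge_min !lexx !orbT.
have [r1 [dr1 [D1 c1 p1 l1 u1]]] := smooth_step (a + dd) dd dd0.
have [r2 [dr2 [D2 c2 p2 l2 u2]]] := smooth_step (b - 2 * dd) dd dd0.
pose c := a + dd; pose d := b - dd.
have cd : c < d by rewrite /c /d; lra.
pose phi x := r1 x - r2 x.
have Dphi (x : R) : is_derive x 1 phi (dr1 x - dr2 x) by exact: is_deriveB.
have dphi : derive1 phi = fun x => dr1 x - dr2 x.
  by apply/funext => x; rewrite derive1E; exact: (@derive_val _ _ _ _ _ _ _ (Dphi x)).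
have dphi_ex x : derivable phi x 1 by have [] := Dphi x.
have cphi : continuous phi.
  by move=> x; apply/differentiable_continuous/derivable1_diffP.
have cdphi : continuous (derive1 phi).
  by rewrite dphi => x; apply: cvgB; [exact: c1|exact: c2].
have JI : `[c, d] `<=` I.
  move=> x /=; rewrite in_itv/= => /andP[x1 x2]; apply: abI; rewrite /= in_itv/=.
  by move: x1 x2; rewrite /c /d => ? ?; apply/andP; split; lra.
have out x : ~ `[c, d]%classic x -> phi x = 0 /\ derive1 phi x = 0.
  rewrite /= in_itv/= => /negP; rewrite negb_and -!ltNge dphi /phi => /orP[xc|dx].
    have [-> ->] := l1 x (ltW xc).
    by have [-> ->] := l2 x ltac:(rewrite /c in xc; lra); rewrite subrr.
  have [-> ->] := u1 x ltac:(rewrite /d in dx; lra).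
  by have [-> ->] := u2 x ltac:(rewrite /d in dx; lra); rewrite !subrr.
have tphi : test_function I phi.
  split => //; exists `[c, d]%classic; split; first exact: segment_compact.
  - exact: JI.
  - by move=> x /out[].
have := wd _ tphi.
rewrite (Rintegral_support I `[c, d])//; last by move=> x _ /out[_ ->]; rewrite mulr0.
rewrite (Rintegral_support I `[c, d])//; last by move=> x _ /out[-> _]; rewrite mulr0.
move=> wE.
have igJ : leb.-integrable `[c, d] (EFin \o g).
  apply/integrableP; split.
    by apply/measurable_EFinP; apply: measurable_funS mg => //; exact: open_measurable.
  by apply: ig => //; exact: segment_compact.
exists c, d, phi; split => //.
- by rewrite /c /d; split; [lra|split; lra].
- move=> x; rewrite /phi; have [_ /andP[? ?]] := p1 x; have [_ /andP[? ?]] := p2 x.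
  have [xb|bx] := leP x (b - 2 * dd).
    by have [-> _] := l2 x xb; apply/andP; split; lra.
  by have [-> _] := u1 x ltac:(lra); apply/andP; split; lra.
have cfJ : {within `[c, d], continuous f}.
  apply: continuous_subspaceW cf => x /=; rewrite !in_itv/= /c /d => /andP[? ?].
  by apply/andP; split; lra.
have cw (w : R -> R) : continuous w -> {within `[c, d], continuous w}.
  exact: continuous_subspaceT.
(* [dr1] and [dr2] are probability densities near [a] and [b]; integrating [f] against them returns
   [f a] and [f b] up to [e / 2] each. *)
have i1 : \int[leb]_(x in `[c, d]) dr1 x = 1.
  rewrite (Rintegral_FTC2 _ r1)//.
  have [-> _] := u1 d ltac:(rewrite /d; lra).
  by have [-> _] := l1 c ltac:(rewrite /c; lra); rewrite subr0.
have i2 : \int[leb]_(x in `[c, d]) dr2 x = 1.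
  rewrite (Rintegral_FTC2 _ r2)//.
  have [-> _] := u2 d ltac:(rewrite /d; lra).
  by have [-> _] := l2 c ltac:(rewrite /c; lra); rewrite subr0.
have m1 := weighted_mean_le c d (f a) (e / 2) f dr1 cfJ (cw _ c1) i1 (fun x => (p1 x).1).
have m2 := weighted_mean_le c d (f b) (e / 2) f dr2 cfJ (cw _ c2) i2 (fun x => (p2 x).1).
have {}m1 : `|\int[leb]_(x in `[c, d]) (f x * dr1 x) - f a| <= e / 2.
  apply: m1 => x /andP[cx xd] nz; apply: Ha.
    by rewrite /= in_itv/=; apply/andP; split; rewrite /c /d in cx xd; lra.
  have [xu|ux] := leP (a + dd + dd) x; first by have [_ E] := u1 x xu; rewrite E eqxx in nz.
  by rewrite ltr_norml; apply/andP; split; rewrite /c in cx; lra.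
have {}m2 : `|\int[leb]_(x in `[c, d]) (f x * dr2 x) - f b| <= e / 2.
  apply: m2 => x /andP[cx xd] nz; apply: Hb.
    by rewrite /= in_itv/=; apply/andP; split; rewrite /c /d in cx xd; lra.
  have [xu|ux] := leP x (b - 2 * dd); first by have [_ E] := l2 x xu; rewrite E eqxx in nz.
  by rewrite ltr_norml; apply/andP; split; rewrite /d in xd; lra.
have ifd (w : R -> R) : continuous w ->
    leb.-integrable `[c, d] (EFin \o fun x => f x * w x).
  by move=> w0; apply: within_integrable => x; apply: cvgM; [exact: cfJ|exact: cw].
have : \int[leb]_(x in `[c, d]) (g x * phi x) =
   \int[leb]_(x in `[c, d]) (f x * dr2 x) - \int[leb]_(x in `[c, d]) (f x * dr1 x).
  rewrite -[LHS]opprK -wE dphi; under eq_Rintegral do rewrite mulrBr.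
  by rewrite RintegralB ?opprB//; exact: ifd.
move=> ->; move: m1 m2; rewrite !ler_norml => /andP[? ?] /andP[? ?].
by apply/andP; split; lra.
Qed.

End WeakDerivative.

Section LinearCombination.
Context d (T : measurableType d) (R : realType) (mu : {measure set T -> \bar R}).
Variables (D : set T) (F G : T -> R) (k l : R).
Hypotheses (mD : measurable D) (iF : mu.-integrable D (EFin \o F))
  (iG : mu.-integrable D (EFin \o G)).

Lemma integrable_linear_combination :
  mu.-integrable D (EFin \o fun x => k * F x + l * G x).
Proof. exact (integrableD mD (integrableZl mD k iF) (integrableZl mD l iG)). Qed.

Lemma Rintegral_linear_combination :
  \int[mu]_(x in D) (k * F x + l * G x) =
  k * \int[mu]_(x in D) F x + l * \int[mu]_(x in D) G x.
Proof.
rewrite -!RintegralZl// RintegralD//.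
- exact (integrableZl mD k iF).
- exact (integrableZl mD l iG).
Qed.

End LinearCombination.

(** * Lipschitz bounds and Jensen's inequality for weak derivatives *)

Section WeakDerivativeConsequences.
Context {R : realType}.
Notation leb := (@lebesgue_measure R).

Lemma integrable_mul_bounded (c d : R) (g phi : R -> R) :
  leb.-integrable `[c, d] (EFin \o g) -> continuous phi ->
  (forall x, 0 <= phi x <= 1) ->
  leb.-integrable `[c, d] (EFin \o fun x => g x * phi x).
Proof.
move=> ig cphi phi01; have mg := measurable_int _ ig.
apply: le_integrable ig => //.
  apply/measurable_EFinP; apply: measurable_funM; first exact/measurable_EFinP.
  by apply: measurable_funTS; exact: continuous_measurable_fun.
move=> x _ /=; rewrite lee_fin normrM; have /andP[p0 p1] := phi01 x.
by rewrite (ger0_norm p0) ler_piMr.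
Qed.

Lemma Rintegral_subset (I J : set R) (F : R -> R) : measurable I -> measurable J ->
  J `<=` I -> leb.-integrable I (EFin \o F) -> (forall x, 0 <= F x) ->
  \int[leb]_(x in J) F x <= \int[leb]_(x in I) F x.
Proof.
move=> mI mJ JI iF F0; apply: fine_le.
- by apply: integrable_fin_num => //; exact: integrableS iF.
- exact: integrable_fin_num.
- apply: ge0_subset_integral => //; first exact: measurable_int iF.
  by move=> x _; rewrite lee_fin.
Qed.

(** Up to [e], the increment is the integral of [g * phi] over a subinterval of []s, t[], where [g]
    is bounded almost everywhere. Continuity up to 0 admits [s = 0]. *)
Lemma weak_derivative_lipschitz (f g : R -> R) (L s t : R) :
  {within `[0, +oo[, continuous f} -> weak_derivative `]0, +oo[ f g ->
  {ae leb, forall x, 0 < x -> `|g x| <= L} -> 0 <= L ->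
  0 <= s -> s <= t -> `|f t - f s| <= L * (t - s).
Proof.
move=> cf wd gL L0 s0; rewrite le_eqVlt => /predU1P[->|st].
  by rewrite !subrr normr0 mulr0.
apply/ler_addgt0Pr => e e0.
have [||c [d [phi [[sc [cd dt]] cphi phi01 ig Hphi]]]] :=
  weak_derivative_increment `]0, +oo[%classic f g s t e st _ _ wd e0.
- by move=> x /=; rewrite !in_itv/= andbT => /andP[sx _]; exact: le_lt_trans sx.
- by apply: continuous_subspaceW cf => x /=; rewrite !in_itv/= andbT => /andP[sx _]; exact: le_trans sx.
have igp := integrable_mul_bounded _ _ _ _ ig cphi phi01.
have : `|\int[leb]_(x in `[c, d]) (g x * phi x)| <= L * (t - s).
  apply: (@le_trans _ _ (L * (d - c))); last by apply: ler_wpM2l => //; lra.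
  rewrite -lee_fin EFin_normr_Rintegral//.
  apply: (@le_trans _ _ (\int[leb]_(x in `[c, d]) `|(g x * phi x)%:E|)%E).
    apply: le_abse_integral => //; exact: measurable_int igp.
  apply: (@le_trans _ _ (\int[leb]_(x in `[c, d]) (L%:E))%E); last first.
    rewrite integral_cst//= lebesgue_measure_itv/= lte_fin cd -EFinB -EFinM.
    exact: lexx.
  apply: ae_ge0_le_integral => //.
  - by apply: measurableT_comp => //; exact: measurable_int igp.
  - move: gL; apply: filterS; first exact: (ae_filter_ringOfSetsType leb).
    move=> x gx; rewrite /= in_itv/= => /andP[cx _].
    have /andP[p0 p1] := phi01 x.
    rewrite lee_fin normrM (ger0_norm p0); apply: (@le_trans _ _ `|g x|).
      by rewrite ler_piMr.
    by apply: gx; lra.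
move=> HL; rewrite -[X in `|X|](subKr (\int[leb]_(x in `[c, d]) (g x * phi x))).
exact: le_trans (ler_normB _ _) (lerD HL Hphi).
Qed.

(* The slope s of f satisfies P s + m s (g - s) <= P g pointwise; this is
   integrated against a test function that is almost 1 on [a, b]. *)
Lemma jensen_increment (I : set R) (f g P m : R -> R) (a b : R) :
  a < b -> measurable I -> `]a, b[ `<=` I -> {within `[a, b], continuous f} ->
  weak_derivative I f g -> subgradient P m -> P 0 = 0 -> m 0 = 0 ->
  leb.-integrable I (EFin \o fun x => P (g x)) ->
  (b - a) * P ((f b - f a) / (b - a)) <= \int[leb]_(x in `]a, b[) P (g x).
Proof.
move=> ab mI abI cf wd Pm P0 m0 iP.
have Pge0 x : 0 <= P x by have := Pm 0 x; rewrite P0 m0; lra.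
set s := (f b - f a) / (b - a).
have ba0 : 0 < b - a by rewrite subr_gt0.
have sE : f b - f a = s * (b - a) by rewrite /s divfK// gt_eqF.
(* This is the coefficient of [phi] in the integrated inequality. As it is nonpositive, the upper
   bound [b - a] on the integral of [phi] suffices. *)
have K0 : P s - m s * s <= 0 by have := Pm s 0; rewrite P0; lra.
suff key (e : R) : 0 < e ->
    (b - a) * P s <= \int[leb]_(x in `]a, b[) P (g x) + e by exact/ler_addgt0Pr.
(* The tolerance is divided by [|m s| + 1] so that the error is at most [e] after multiplication by
   [m s], which may be 0. *)
move=> e0; have ms0 : 0 < `|m s| + 1 by have := normr_ge0 (m s); lra.
have e10 : 0 < e / (`|m s| + 1) by rewrite divr_gt0.
have [c [d [phi [[ac [cd db]] cphi phi01 ig Hphi]]]] :=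
  weak_derivative_increment I f g a b _ ab abI cf wd e10.
have cdab : `[c, d] `<=` `]a, b[.
  by move=> x /=; rewrite !in_itv/= => /andP[? ?]; apply/andP; split; lra.
have iPab : leb.-integrable `]a, b[ (EFin \o fun x => P (g x)) by exact: integrableS iP.
have iPcd : leb.-integrable `[c, d] (EFin \o fun x => P (g x)) by exact: integrableS iPab.
have igp := integrable_mul_bounded _ _ _ _ ig cphi phi01.
have ip : leb.-integrable `[c, d] (EFin \o phi).
  by apply: within_integrable; exact: continuous_subspaceT.
have : \int[leb]_(x in `[c, d]) ((P s - m s * s) * phi x + m s * (g x * phi x))
    <= \int[leb]_(x in `[c, d]) P (g x).
  apply: le_Rintegral => //.
    exact: integrable_linear_combination.
  move=> x _; have /andP[p0 p1] := phi01 x.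
  have := ler_wpM2r p0 (Pm s (g x)); have := ler_wpM2l (Pge0 (g x)) p1.
  by lra.
rewrite Rintegral_linear_combination//.
have := Rintegral_subset _ _ _ (measurable_itv _) (measurable_itv _) cdab iPab (fun x => Pge0 (g x)).
have : \int[leb]_(x in `[c, d]) phi x <= b - a.
  apply: (@le_trans _ _ (\int[leb]_(x in `[c, d]) 1)).
    apply: le_Rintegral => //.
      by apply: within_integrable; apply: continuous_subspaceT; exact: cst_continuous.
    by move=> x _; have /andP[] := phi01 x.
  by rewrite Rintegral_itv_cst ?ltW//; lra.
set A := \int[leb]_(x in _) phi x; set B := \int[leb]_(x in _) P (g x).
set C := \int[leb]_(x in _) P (g x); move=> Aba BC.
have Ab : (P s - m s * s) * (b - a) <= (P s - m s * s) * A by exact: ler_wnM2l.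
have : m s * (s * (b - a)) - e <= m s * \int[leb]_(x in `[c, d]) (g x * phi x).
  rewrite -sE; set G := Rintegral _ _ _.
  have : `|m s * (G - (f b - f a))| <= e.
    rewrite normrM; apply: (@le_trans _ _ (`|m s| * (e / (`|m s| + 1)))).
      exact: ler_wpM2l.
    by rewrite mulrCA; apply: ler_piMr; [exact: ltW|rewrite ler_pdivrMr// mul1r lerDl].
  by rewrite ler_norml mulrBr => /andP[? ?]; lra.
by lra.
Qed.

(** Nodal interpolation does not raise the energy of the datum, on any mesh. The integrals over open
    cells are added with the nodes left out, as [P >= 0]. *)
Lemma jensen_cells (ell : R) (N : nat) (f g P m : R -> R) :
  0 < ell -> (0 < N)%N -> {within `[0, ell], continuous f} ->
  weak_derivative `]0, ell[ f g -> subgradient P m -> P 0 = 0 -> m 0 = 0 ->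
  leb.-integrable `]0, ell[ (EFin \o fun x => P (g x)) ->
  \sum_(i < N) ell / N%:R * P (slope (ell / N%:R) (f \o node ell N) i)
  <= \int[leb]_(x in `]0, ell[) P (g x).
Proof.
move=> ell0 N0 cf wd Pm P0 m0 iP; have h0 := mesh_gt0 ell N ell0 N0.
have Pge0 x : 0 <= P x by have := Pm 0 x; rewrite P0 m0; lra.
have key n : (n <= N)%N ->
    \sum_(i < n) ell / N%:R * P (slope (ell / N%:R) (f \o node ell N) i)
    <= \int[leb]_(x in `]0, node ell N n[) P (g x).
  elim: n => [|n IH] nN; first by rewrite big_ord0; apply: Rintegral_ge0.
  rewrite big_ord_recr/=; set a := node ell N n; set b := node ell N n.+1.
  have /andP[a0 aell] : 0 <= a <= ell := node_in ell N n ell0 N0 (ltnW nN).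
  have /andP[b0 bell] : 0 <= b <= ell := node_in ell N n.+1 ell0 N0 nN.
  have bE : b = a + ell / N%:R by rewrite /b nodeS.
  have ab : a < b by rewrite bE ltrDl.
  have sub1 : `]a, b[ `<=` `]0, ell[.
    move=> x /=; rewrite !in_itv/= => /andP[? ?].
    by apply/andP; split; lra.
  have := jensen_increment `]0, ell[%classic f g P m a b ab (measurable_itv _) sub1 _ wd Pm P0 m0 iP.
  have -> : b - a = ell / N%:R by rewrite bE addrC addKr.
  move=> /(_ _)J; apply: le_trans (lerD (IH (ltnW nN)) (J _)) _.
    apply: continuous_subspaceW cf => x /=; rewrite !in_itv/= => /andP[? ?].
    by apply/andP; split; lra.
  rewrite -/a -/b.
  have iab : leb.-integrable (`]0, a[ `|` `]a, b[) (EFin \o fun x => P (g x)).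
    apply: integrableS iP => //; first exact: measurableU.
    move=> x [|/sub1//]; rewrite /= !in_itv/= => /andP[? ?].
    by apply/andP; split; lra.
  rewrite -Rintegral_setU//; last first.
    by apply/disj_setPS => y [/=]; rewrite !in_itv/= => /andP[_ +] /andP[+ _]; case: ltgtP.
  apply: Rintegral_subset => //; first exact: measurableU.
    move=> x [|]; rewrite /= !in_itv/= => /andP[? ?].
      by apply/andP; split; lra.
    by apply/andP; split; lra.
  apply: integrableS iP => // x /=; rewrite !in_itv/= => /andP[? ?].
  by apply/andP; split; lra.
by have := key N (leqnn N); rewrite nodeN.
Qed.

End WeakDerivativeConsequences.

(** * The scheme *)

Section SchemeNodal.
Context {R : realType}.
Variables (ell : R) (N : nat) (alpha : R) (beta mu : R -> R).
Notation h := (ell / N%:R).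
Notation xn := (node ell N).

(** Any sequence [V] is attained at the nodes by [interp ell N V], so testing with [V_h] amounts to
    testing with all sequences. *)
Lemma balance_of_Vh (f : nat -> R) (d w : R -> R) :
  0 < ell -> (0 < N)%N -> Vh ell N w ->
  (forall v, Vh ell N v ->
    mass h N (fun i => f i * v (xn i)) + inner ell (mu \o derive1 w) (derive1 v)
    + alpha * inner_bd ell w v = alpha * inner_bd ell d v) ->
  nodal_balance h N alpha mu f (d 0) (d ell) (w \o xn).
Proof.
move=> ell0 N0 Vw H V; have h0 := mesh_gt0 ell N ell0 N0.
have VV := Vh_interp ell N V h0.
have := H _ VV; rewrite (inner_mu_nodal ell N)// /inner_bd.
have iE i : (i <= N)%N -> interp ell N V (xn i) = V i by exact: interp_node.
have v0 : interp ell N V 0 = V 0%N by rewrite -(iE 0%N)// node0.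
have vN : interp ell N V ell = V N by rewrite -[in RHS]iE// nodeN.
rewrite v0 vN /= node0 (nodeN ell N N0) => <-; congr (_ + _ + _).
  by apply: eq_mass => i iN; rewrite iE.
by apply: eq_bigr => i _; rewrite {4}/slope/= !iE// ltnW.
Qed.

Lemma scheme_nodal (tau : R) (u0 : R -> R) (ud : R -> R -> R) (u : nat -> R -> R) k :
  0 < ell -> (0 < N)%N -> discrete_scheme ell N alpha beta mu tau u0 ud u ->
  (0 < k)%N ->
  nodal_balance h N alpha mu
    (fun i => (beta (u k (xn i)) - beta (u k.-1 (xn i))) / tau)
    (ud (k%:R * tau) 0) (ud (k%:R * tau) ell) (u k \o xn).
Proof.
move=> ell0 N0 [Vu _ sch] k0; apply: balance_of_Vh => // v Vv.
by rewrite -sch// inner_h_nodal.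
Qed.

Lemma stationary_nodal (ubar uhat : R -> R) : 0 < ell -> (0 < N)%N ->
  discrete_stationary ell N alpha mu ubar uhat ->
  nodal_balance h N alpha mu (fun=> 0) (ubar 0) (ubar ell) (uhat \o xn).
Proof.
move=> ell0 N0 [Vu st]; apply: balance_of_Vh => // v Vv.
rewrite -st// /mass big1 ?add0r// => i _.
by rewrite !mul0r addr0 mulr0.
Qed.

(** Induction in time: a new nodal value above [up] exceeds the previous one, so the increment of
    [beta] has the sign that the maximum principle requires; likewise below [lo]. *)
Lemma scheme_bounds (tau lo up : R) (u0 : R -> R) (ud : R -> R -> R)
    (u : nat -> R -> R) :
  0 < ell -> 0 < alpha -> (0 < N)%N -> 0 < tau ->
  {homo beta : x y / x < y} -> {homo mu : x y / x < y} -> mu 0 = 0 ->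
  (forall x, x \in `[0, ell] -> lo <= u0 x <= up) ->
  (forall x t, x = 0 \/ x = ell -> 0 <= t -> lo <= ud t x <= up) ->
  discrete_scheme ell N alpha beta mu tau u0 ud u ->
  forall k i, (i <= N)%N -> lo <= u k (xn i) <= up.
Proof.
move=> ell0 alpha0 N0 tau0 beta_incr mu_incr mu0 u0b udb sch.
have h0 := mesh_gt0 ell N ell0 N0.
elim=> [|k IH] i iN.
  have xin : xn i \in `[0, ell] by rewrite in_itv/=; exact: node_in.
  have [_ -> // _] := sch.
  by rewrite -[Ih _ _ _ _]/(interp ell N (u0 \o xn) (xn i)) interp_node// u0b.
have bal := scheme_nodal tau u0 ud u k.+1 ell0 N0 sch (ltn0Sn k).
have t0 : 0 <= k.+1%:R * tau by rewrite mulr_ge0 ?ler0n ?ltW.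
have /andP[l0 g0] := udb 0 _ (or_introl erefl) t0.
have /andP[l1 g1] := udb ell _ (or_intror erefl) t0.
apply/andP; split.
- apply: (nodal_ge_min _ _ _ _ _ _ _ _ _ h0 alpha0 mu_incr mu0 bal l0 l1) => // j jN /= uj.
  have /andP[IH1 _] := IH j jN.
  rewrite pmulr_lle0 ?invr_gt0// subr_le0; apply/ltW/beta_incr.
  exact: lt_le_trans IH1.
- apply: (nodal_le_max _ _ _ _ _ _ _ _ _ h0 alpha0 mu_incr mu0 bal g0 g1) => // j jN /= uj.
  have /andP[_ IH1] := IH j jN.
  rewrite pmulr_lge0 ?invr_gt0// subr_ge0; apply/ltW/beta_incr.
  exact: le_lt_trans uj.
Qed.

Lemma stationary_bounds (lo up : R) (ubar uhat : R -> R) :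
  0 < ell -> 0 < alpha -> (0 < N)%N ->
  {homo mu : x y / x < y} -> mu 0 = 0 ->
  (forall x, x = 0 \/ x = ell -> lo <= ubar x <= up) ->
  discrete_stationary ell N alpha mu ubar uhat ->
  forall i, (i <= N)%N -> lo <= uhat (xn i) <= up.
Proof.
move=> ell0 alpha0 N0 mu_incr mu0 ub st i iN; have h0 := mesh_gt0 ell N ell0 N0.
have bal := stationary_nodal _ _ ell0 N0 st.
have /andP[l0 g0] := ub 0 (or_introl erefl).
have /andP[l1 g1] := ub ell (or_intror erefl).
apply/andP; split.
- exact: (nodal_ge_min _ _ _ _ _ _ _ _ _ h0 alpha0 mu_incr mu0 bal l0 l1).
- exact: (nodal_le_max _ _ _ _ _ _ _ _ _ h0 alpha0 mu_incr mu0 bal g0 g1).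
Qed.

Lemma Vh_scale (c : R) (v : R -> R) : Vh ell N v -> Vh ell N (fun x => v x / c).
Proof.
move=> [cv av]; split; first by move=> x; apply: cvgM; [exact: cv|exact: cvg_cst].
move=> i iN; have [a [b vE]] : exists a b : R, forall x,
  x \in `[xn i, xn i.+1] -> v x = a * x + b := av i iN.
by exists (a / c), (b / c) => x xi; rewrite vE//; ring.
Qed.

Lemma L2norm_sqr (v : R -> R) : L2norm ell v ^+ 2 = inner ell v v.
Proof.
by rewrite sqr_sqrtr//; apply: Rintegral_ge0 => x _; rewrite -expr2 sqr_ge0.
Qed.

End SchemeNodal.

(** * The work of the boundary data *)

Section DiscreteWork.
Context {R : realType}.
Variables (tau t0 L up : R) (d U : nat -> R).
Hypotheses (tau0 : 0 < tau) (t00 : 0 <= t0) (L0 : 0 <= L)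
  (Ub : forall k, 0 <= U k <= up) (db : forall k, 0 <= d k <= up)
  (dL : forall k, `|d k.+1 - d k| <= L * tau)
  (dst : forall k, t0 <= k%:R * tau -> d k.+1 = d k).

(** Steps ending before [t0] contribute at most [L * tau] each, and those starting after it nothing.
    The step that reaches [t0] may be long, as [tau] is unrestricted, and is bounded by the range of
    the data instead. *)
Lemma total_variation_le K : \sum_(k < K) `|d k.+1 - d k| <= L * t0 + up.
Proof.
have up0 : 0 <= up by have /andP[h1 h2] := Ub 0%N; exact: le_trans h2.
suff key : \sum_(k < K) `|d k.+1 - d k| <=
    if t0 <= K%:R * tau then L * t0 + up else L * (K%:R * tau).
  apply: le_trans key _; case: ifP => // /negbT; rewrite -ltNge => KT.
  by have := ler_wpM2l L0 (ltW KT); have := up0; lra.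
elim: K => [|K IH].
  by rewrite big_ord0 mul0r mulr0; case: ifP => // _; rewrite addr_ge0// mulr_ge0.
rewrite big_ord_recr/=; move: IH; have := dL K; have := tau0.
have [tK _ _ IH|Kt tau0' H IH] := leP t0 (K%:R * tau).
  rewrite dst// subrr normr0 addr0 ifT//.
  by rewrite (le_trans tK)// ler_pM2r// ler_nat.
have [tK1|Kt1] := leP t0 (K.+1%:R * tau); last by rewrite -natr1; lra.
apply: lerD; first by apply: le_trans IH _; rewrite ler_wpM2l// ltW.
have /andP[a1 a2] := db K.+1; have /andP[b1 b2] := db K.
by rewrite ler_norml; apply/andP; split; lra.
Qed.

(* Summation by parts moves the differences onto the data. *)
Lemma discrete_work_le K :
  \sum_(k < K) d k.+1 * (U k.+1 - U k) <= up * up + up * (L * t0 + up).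
Proof.
have up0 : 0 <= up by have /andP[h1 h2] := Ub 0%N; exact: le_trans h2.
have abel : \sum_(k < K) d k.+1 * (U k.+1 - U k) =
    d K * U K - d 0%N * U 0%N - \sum_(k < K) (d k.+1 - d k) * U k.
  elim: K => [|K IH]; first by rewrite !big_ord0; ring.
  by rewrite !big_ord_recr/= IH; ring.
rewrite abel; have /andP[a1 a2] := db K; have /andP[b1 b2] := Ub K.
have /andP[e1 e2] := db 0%N; have /andP[f1 f2] := Ub 0%N.
have H1 : d K * U K <= up * up by exact: ler_pM.
have H2 : 0 <= d 0%N * U 0%N by exact: mulr_ge0.
have H3 : - \sum_(k < K) (d k.+1 - d k) * U k <= up * (L * t0 + up).
  apply: (@le_trans _ _ (up * \sum_(k < K) `|d k.+1 - d k|)); last first.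
    by apply: ler_wpM2l => //; exact: total_variation_le.
  rewrite -sumrN mulr_sumr; apply: ler_sum => k _.
  apply: le_trans (ler_norm _) _; rewrite normrN normrM mulrC.
  have /andP[c1 c2] := Ub k; rewrite (ger0_norm c1).
  exact: ler_wpM2r.
by lra.
Qed.

End DiscreteWork.

Lemma boundary_lipschitz {R : realType} (ell lo up : R) (ud : R -> R -> R) (x : R) :
  boundary_datum ell lo up ud -> x = 0 \/ x = ell ->
  exists2 L, 0 <= L & forall s t, 0 <= s -> s <= t -> `|ud t x - ud s x| <= L * (t - s).
Proof.
move=> bd /bd[cu _ [g [wd [L gL]]]]; exists (Num.max 0 L).
  by rewrite le_max lexx.
have L0 : 0 <= Num.max 0 L by rewrite le_max lexx.
have gL0 : {ae (@lebesgue_measure R), forall y, 0 < y -> `|g y| <= Num.max 0 L}.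
  move: gL; apply: filterS; first exact: (ae_filter_ringOfSetsType lebesgue_measure).
  by move=> y yL y0; rewrite le_max yL// orbT.
by move=> s t; exact: (weak_derivative_lipschitz (ud ^~ x) g _ s t cu wd gL0 L0).
Qed.

(** * Decay and time differences for the given data *)

Section Main.
Context {R : realType}.
Variables (ell alpha T t0 ulow uup : R) (beta mu u0 ubar : R -> R) (ud : R -> R -> R).
Hypotheses (hell : 0 < ell) (halpha : 0 < alpha).
Hypotheses (hbeta : constitutive beta) (hmu : constitutive mu) (hmu0 : mu 0 = 0).
Hypothesis hulow : 0 < ulow.
Hypothesis hu0 : initial_datum mu ell ulow uup u0.
Hypothesis hud : boundary_datum ell ulow uup ud.
Hypothesis hubar : forall x, x = 0 \/ x = ell -> ulow <= ubar x <= uup.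

Let beta_incr := constitutive_incr beta hbeta.
Let mu_incr := constitutive_incr mu hmu.

Lemma subgradient_constitutive (f : R -> R) : constitutive f ->
  subgradient (primitive0 f) f.
Proof.
move=> hf; apply: subgradient_primitive0; first by have [] := hf.
by move=> x y; rewrite le_eqVlt => /predU1P[->//|/(constitutive_incr f hf)/ltW].
Qed.

Let B := primitive0 beta.
Let Bb : subgradient B beta := subgradient_constitutive beta hbeta.

(** The interval is enlarged by 1 to have distinct ends, as [energy_step] requires, even if
    [ulow = uup]. *)
Lemma bilipschitz_beta :
  exists b0 b1, [/\ 0 < b0, 0 < b1 & bilipschitz_on ulow (uup + 1) b0 b1 beta].
Proof.
have /andP[h1 h2] := hubar 0 (or_introl erefl); have h3 := hulow.
apply: constitutive_bilipschitz => //; first by lra.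
by move=> x /andP[lx _]; rewrite gt_eqF// (lt_le_trans _ lx).
Qed.

Let bounds (N : nat) (tau : R) (u : nat -> R -> R) :
  (0 < N)%N -> 0 < tau -> discrete_scheme ell N alpha beta mu tau u0 ud u ->
  forall k i, (i <= N)%N -> ulow <= u k (node ell N i) <= uup.
Proof.
move=> N0 tau0 sch; have [_ u0b _] := hu0.
apply: (scheme_bounds _ _ _ _ _ _ _ _ _ _ _ hell halpha N0 tau0 beta_incr mu_incr hmu0 u0b _ sch).
by move=> x t xb t0'; have [_ + _] := hud x xb; exact.
Qed.

(** Slope 0 forces equal boundary values, the case that [nondegenerate_equilibrium] covers; at any
    other slope [mu] has a positive derivative. *)
Lemma equilibrium_strongly_increasing (s : R) :
  nondegenerate_equilibrium ell mu ubar ->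
  2 * mu s + alpha * ell * s = alpha * (ubar ell - ubar 0) ->
  exists m d, [/\ 0 < m, 0 < d & strongly_increasing_at m d mu s].
Proof.
move=> nd; have [->|s0 _] := eqVneq s 0; last exact: constitutive_strongly_increasing.
rewrite hmu0 !mulr0 addr0 => /esym/eqP.
rewrite mulf_eq0 (gt_eqF halpha)/= subr_eq0 => /eqP/esym/nd[m [d [m0 d0 H]]].
exists m, d; split => //; apply: strongly_increasing_of_near => // x.
rewrite !subr0 hmu0 subr0 => /H {}H.
have -> : mu x * x = `|mu x| * `|x|.
  have [x0|x0|->] := ltgtP x 0; last by rewrite normr0 !mulr0.
  - have := mu_incr _ _ x0; rewrite hmu0 => mx0.
    by rewrite !ltr0_norm// mulrNN.
  - have := mu_incr _ _ x0; rewrite hmu0 => mx0.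
    by rewrite !gtr0_norm.
rewrite -real_normK ?num_real// expr2 mulrA; exact: ler_wpM2r.
Qed.

(** The left side is strictly increasing in the slope. All meshes therefore share one slope and one
    decay rate. *)
Lemma slope_unique (s s' : R) :
  2 * mu s + alpha * ell * s = alpha * (ubar ell - ubar 0) ->
  2 * mu s' + alpha * ell * s' = alpha * (ubar ell - ubar 0) -> s = s'.
Proof.
move=> E E'; apply: (mono_mul_eq0 mu mu_incr); apply/eqP; rewrite eq_le.
rewrite (mono_mul_ge0 mu mu_incr) andbT.
have := mulr_ge0 (ltW (mulr_gt0 halpha hell)) (sqr_ge0 (s - s')).
have -> : mu s - mu s' = - (alpha * ell * (s - s')) / 2 by lra.
by rewrite expr2; lra.
Qed.

Lemma energy_decay_rate : exists2 c, 0 < c &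
  forall (N : nat) (tau : R) (u : nat -> R -> R) (uhat : R -> R) k,
    (0 < N)%N -> 0 < tau ->
    discrete_scheme ell N alpha beta mu tau u0 ud u ->
    discrete_stationary ell N alpha mu ubar uhat ->
    (forall x, x = 0 \/ x = ell -> ud (k.+1%:R * tau) x = ubar x) ->
    let E n := mass (ell / N%:R) N (fun i =>
      bregman B beta (uhat (node ell N i)) (u n (node ell N i))) in
    E k.+1 <= E k /\
    (nondegenerate_equilibrium ell mu ubar -> (1 + c * tau) * E k.+1 <= E k).
Proof.
have [b0 [b1 [b00 b10 bb]]] := bilipschitz_beta.
have lou : ulow < uup + 1.
  by have /andP[h1 h2] := hubar 0 (or_introl erefl); lra.
pose Q s := 2 * mu s + alpha * ell * s = alpha * (ubar ell - ubar 0).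
have Qs N uhat : (0 < N)%N -> discrete_stationary ell N alpha mu ubar uhat ->
    exists2 s, Q s & forall i, (i < N)%N -> slope (ell / N%:R) (uhat \o node ell N) i = s.
  move=> N0 st; have h0 := mesh_gt0 ell N hell N0.
  have bal := stationary_nodal ell N alpha mu ubar uhat hell N0 st.
  have [sl q] := stationary_slope _ _ _ _ _ _ _ h0 N0 mu_incr bal.
  move: sl q; set s := _ / (_ * _) => sl q; exists s; last exact: sl.
  by move: q; rewrite /Q; move: (s) => s'; rewrite meshE.
have [c c0 Hc] : exists2 c, 0 < c & forall (N : nat) (tau : R) (u : nat -> R -> R)
    (uhat : R -> R) k, (0 < N)%N -> 0 < tau ->
    discrete_scheme ell N alpha beta mu tau u0 ud u ->
    discrete_stationary ell N alpha mu ubar uhat ->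
    (forall x, x = 0 \/ x = ell -> ud (k.+1%:R * tau) x = ubar x) ->
    nondegenerate_equilibrium ell mu ubar ->
    (1 + c * tau) * mass (ell / N%:R) N (fun i =>
      bregman B beta (uhat (node ell N i)) (u k.+1 (node ell N i)))
    <= mass (ell / N%:R) N (fun i =>
      bregman B beta (uhat (node ell N i)) (u k (node ell N i))).
  (* The rate is fixed before the mesh, but a slope is known to exist only once a stationary
     solution is given. In the other case the claim is void and any rate will do. *)
  have [[nd [s sQ]]|no] := pselect (nondegenerate_equilibrium ell mu ubar /\ exists s, Q s).
    have [m [d [m0 d0 sm]]] := equilibrium_strongly_increasing s nd sQ.
    have [c c0 Hc] := energy_step ell alpha ulow (uup + 1) b0 b1 m d s beta B mu
      hell halpha lou b10 Bb bb mu_incr m0 d0 sm.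
    exists c => // N tau u uhat k N0 tau0 sch st bdk _.
    have h0 := mesh_gt0 ell N hell N0.
    have balk := scheme_nodal ell N alpha beta mu tau u0 ud u k.+1 hell N0 sch (ltn0Sn k).
    rewrite (bdk 0 (or_introl erefl)) (bdk ell (or_intror erefl)) in balk.
    have bals := stationary_nodal ell N alpha mu ubar uhat hell N0 st.
    have [s' sQ' sl] := Qs N uhat N0 st.
    rewrite (slope_unique _ _ sQ' sQ) in sl.
    apply: (Hc _ _ _ _ _ _ _ _ h0 (meshE ell N N0) tau0 balk bals _ _ sl) => i iN /=.
    - by have /andP[? ?] := bounds N tau u N0 tau0 sch k.+1 i iN; apply/andP; split; lra.
    - have /andP[? ?] := stationary_bounds ell N alpha mu ulow uup ubar uhat hell halpha N0 mu_incr hmu0 hubar st i iN.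
      by apply/andP; split; lra.
  exists 1 => // N tau u uhat k N0 tau0 sch st bdk nd; exfalso; apply: no.
  by split => //; have [s sQ _] := Qs N uhat N0 st; exists s.
exists c => // N tau u uhat k N0 tau0 sch st bdk E; split; last exact: Hc bdk.
have h0 := mesh_gt0 ell N hell N0.
have balk := scheme_nodal ell N alpha beta mu tau u0 ud u k.+1 hell N0 sch (ltn0Sn k).
rewrite (bdk 0 (or_introl erefl)) (bdk ell (or_intror erefl)) in balk.
have bals := stationary_nodal ell N alpha mu ubar uhat hell N0 st.
apply: le_trans (contraction_step _ _ _ _ _ _ _ _ _ _ _ _ h0 tau0 Bb balk bals).
rewrite lerDl; apply: mulr_ge0; first exact: ltW.
apply: addr_ge0; last by apply: mulr_ge0; [exact: ltW|apply: addr_ge0; exact: sqr_ge0].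
apply: sumr_ge0 => i _; apply: mulr_ge0; first exact: ltW.
exact: mono_mul_ge0.
Qed.

Lemma exponential_decay : 0 < T -> 0 <= t0 ->
  exists c1 c2 : R, [/\ 0 < c1, 0 < c2 &
    forall (N : nat) (tau : R) (u : nat -> R -> R) (uhat : R -> R),
      (0 < N)%N -> 0 < tau <= T ->
      (forall k : nat, t0 <= k%:R * tau ->
        forall x, x = 0 \/ x = ell -> ud (k%:R * tau) x = ubar x) ->
      discrete_scheme ell N alpha beta mu tau u0 ud u ->
      discrete_stationary ell N alpha mu ubar uhat ->
      forall j k : nat, (j <= k)%N -> t0 <= j%:R * tau ->
        k%:R * tau <= T \/ nondegenerate_equilibrium ell mu ubar ->
        L2norm ell (u k \- uhat)
        <= c1 * expR (- c2 * (k%:R * tau - j%:R * tau))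
           * L2norm ell (u j \- uhat)].
Proof.
move=> hT ht0; have [c c0 Hc] := energy_decay_rate.
have [b0 [b1 [b00 b10 bb]]] := bilipschitz_beta.
pose g := c / (1 + c * T).
have cT0 : 0 < 1 + c * T by rewrite addr_gt0// mulr_gt0.
have g0 : 0 < g by rewrite divr_gt0.
(* The factors are [4 / b0] and [b1] from comparing the Bregman distance with the square, 3 from the
   trapezoidal rule, and [expR (g * T)] for a bounded horizon. Passing from squares to norms takes
   the root of [K] and halves [g]. *)
pose K := 12 * b1 / b0 * expR (g * T).
have K0 : 0 < K by rewrite mulr_gt0 ?expR_gt0// divr_gt0// mulr_gt0.
exists (Num.sqrt K), (g / 2); split; [by rewrite sqrtr_gt0|by rewrite divr_gt0|].
move=> N tau u uhat N0 tauT bd sch st j k jk t0j nd.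
have /andP[tau0 tauT'] := tauT.
have h0 := mesh_gt0 ell N hell N0.
pose E n := mass (ell / N%:R) N (fun i =>
      bregman B beta (uhat (node ell N i)) (u n (node ell N i))).
pose W n := mass (ell / N%:R) N (fun i => (u n \- uhat) (node ell N i) ^+ 2).
have bdn n : (j <= n)%N -> forall x, x = 0 \/ x = ell -> ud (n.+1%:R * tau) x = ubar x.
  move=> jn; apply: bd; apply: le_trans t0j _.
  by rewrite ler_pM2r// ler_nat (leq_trans jn).
have EW n : b0 / 4 * W n <= E n <= b1 * W n.
  rewrite /W -!massZ; apply/andP.
  have br i (iN : (i <= N)%N) : b0 / 4 * (u n \- uhat) (node ell N i) ^+ 2
      <= bregman B beta (uhat (node ell N i)) (u n (node ell N i))
      <= b1 * (u n \- uhat) (node ell N i) ^+ 2.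
    apply: bregman_bounds Bb bb _ _.
      have /andP[? ?] := stationary_bounds ell N alpha mu ulow uup ubar uhat hell halpha N0 mu_incr hmu0 hubar st i iN.
      by apply/andP; split; lra.
    by have /andP[? ?] := bounds N tau u N0 tau0 sch n i iN; apply/andP; split; lra.
  by split; apply: mass_le => // i iN; have /andP[] := br i iN.
have W0 n : 0 <= W n by apply: mass_ge0 => // i _; exact: sqr_ge0.
have E0 n : 0 <= E n.
  have /andP[H _] := EW n; apply: le_trans H; apply: mulr_ge0 => //.
  by rewrite divr_ge0// ltW.
have mon n : (j <= n)%N -> E n.+1 <= E n.
  by move=> jn; have [] := Hc N tau u uhat n N0 tau0 sch st (bdn n jn).
have Ekj : E k <= expR (g * T) * expR (- g * (k%:R * tau - j%:R * tau)) * E j.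
  have jk0 : 0 <= j%:R * tau by rewrite mulr_ge0 ?ler0n ?ltW.
  (* Up to time [T] the energy is only known not to increase, but there [expR (g * T)] compensates
     the decay factor. *)
  case: nd => [kT|nd].
    apply: (@le_trans _ _ (1 * E j)).
      rewrite mul1r; elim: k jk {kT} => [|k IH].
        by rewrite leqn0 => /eqP ->.
      rewrite leq_eqVlt => /predU1P[->//|jk].
      exact: le_trans (mon k jk) (IH jk).
    apply: ler_wpM2r => //; rewrite -expRD -[leLHS]expR0 ler_expR.
    by rewrite mulNr -mulrBr; apply: mulr_ge0; [exact: ltW|lra].
  apply: (@le_trans _ _ (expR (- g * (k%:R * tau - j%:R * tau)) * E j)).
    apply: geometric_decay => // n /andP[jn _].
    by have [_] := Hc N tau u uhat n N0 tau0 sch st (bdn n jn); exact.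
  apply: ler_wpM2r => //; rewrite ler_peMl ?expR_ge0//.
  by rewrite -[leLHS]expR0 ler_expR mulr_ge0 ?ltW.
have Vw n : Vh ell N (u n \- uhat) by apply: VhB; [case: sch|case: st].
have /andP[Ik _] := inner_sqr_bounds ell N _ hell N0 (Vw k).
have /andP[_ Ij] := inner_sqr_bounds ell N _ hell N0 (Vw j).
have /andP[Ek _] := EW k; have /andP[_ Ej] := EW j.
have x0 := expR_ge0 (- g * (k%:R * tau - j%:R * tau)).
have main : inner ell (u k \- uhat) (u k \- uhat) <=
    K * expR (- g * (k%:R * tau - j%:R * tau)) * inner ell (u j \- uhat) (u j \- uhat).
  apply: le_trans Ik _; rewrite -/(W k).
  have Wk : W k <= 4 / b0 * E k.
    have -> : W k = 4 / b0 * (b0 / 4 * W k) by field; rewrite gt_eqF.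
    by rewrite ler_pM2l// divr_gt0.
  apply: le_trans Wk _.
  have Ej3 : E j <= b1 * (3 * inner ell (u j \- uhat) (u j \- uhat)).
    by apply: le_trans Ej _; rewrite ler_pM2l.
  rewrite {1}/K; set X := expR (g * T); set Y := expR _; set I := inner _ _ _.
  have -> : 12 * b1 / b0 * X * Y * I = 4 / b0 * (X * Y * (b1 * (3 * I))).
    by field; rewrite gt_eqF.
  rewrite ler_pM2l ?divr_gt0//; apply: le_trans Ekj _.
  by apply: ler_wpM2l => //; rewrite mulr_ge0// expR_ge0.
rewrite -ler_sqr ?nnegrE ?sqrtr_ge0//; last first.
  by rewrite !mulr_ge0// ?expR_ge0 ?sqrtr_ge0.
rewrite !exprMn !L2norm_sqr sqr_sqrtr ?(ltW K0)//.
have -> : expR (- (g / 2) * (k%:R * tau - j%:R * tau)) ^+ 2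
   = expR (- g * (k%:R * tau - j%:R * tau)).
  by rewrite expr2 -expRD; congr expR; field.
exact: main.
Qed.

Let M := primitive0 mu.
Let Mm : subgradient M mu := subgradient_constitutive mu hmu.

Lemma time_difference_bound : 0 <= t0 -> exists C : R,
    forall (N : nat) (tau : R) (u : nat -> R -> R),
      (0 < N)%N -> 0 < tau ->
      (forall k : nat, t0 <= k%:R * tau ->
        forall x, x = 0 \/ x = ell -> ud (k%:R * tau) x = ubar x) ->
      discrete_scheme ell N alpha beta mu tau u0 ud u ->
      forall K : nat,
        \sum_(1 <= k < K.+1) tau * L2norm ell (dtau tau u k) ^+ 2 <= C.
Proof.
move=> ht0; have [b0 [b1 [b00 b10 bb]]] := bilipschitz_beta.
have [cu0 u0b [g [wg ig]]] := hu0.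
have [L0 L00 HL0] := boundary_lipschitz ell ulow uup ud 0 hud (or_introl erefl).
have [L1 L10 HL1] := boundary_lipschitz ell ulow uup ud ell hud (or_intror erefl).
pose IM := \int[lebesgue_measure]_(x in `]0, ell[) M (g x).
pose w L := uup * uup + uup * (L * t0 + uup).
exists ((IM + alpha * uup ^+ 2 + alpha * (w L0 + w L1)) / b0).
move=> N tau u N0 tau0 bd sch K.
have h0 := mesh_gt0 ell N hell N0; set h := ell / N%:R.
have ub := bounds N tau u N0 tau0 sch.
pose U k i := u k (node ell N i).
have ub0 k i : (i <= N)%N -> 0 <= U k i <= uup.
  by move=> iN; have /andP[? ?] := ub k i iN; have ? := hulow; rewrite /U; apply/andP; split; lra.
have up0 : 0 <= uup by have /andP[h1 h2] := ub0 0%N 0%N (leq0n N); exact: le_trans h2.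
pose P k := \sum_(i < N) h * M (slope h (U k) i)
  + alpha / 2 * (U k 0%N ^+ 2 + U k N ^+ 2).
pose D k := tau * L2norm ell (dtau tau u k) ^+ 2.
have M0 : M 0 = 0 by exact: primitive00.
have Mge0 x : 0 <= M x by have := Mm 0 x; rewrite M0 hmu0; lra.
have P_ge0 k : 0 <= P k.
  apply: addr_ge0; first by apply: sumr_ge0 => i _; apply: mulr_ge0 => //; exact: ltW.
  apply: mulr_ge0; first by rewrite divr_ge0// ltW.
  by apply: addr_ge0; exact: sqr_ge0.
have P0 : P 0%N <= IM + alpha * uup ^+ 2.
  have U0E i : (i <= N)%N -> U 0%N i = u0 (node ell N i).
    move=> iN; have [_ uE _] := sch; rewrite /U uE; last by rewrite in_itv/= node_in.
    by rewrite -[LHS]/(interp ell N (u0 \o node ell N) (node ell N i)) interp_node.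
  apply: lerD.
    apply: le_trans (jensen_cells ell N u0 g M mu hell N0 cu0 wg Mm M0 hmu0 ig).
    apply: ler_sum => i _; rewrite /slope /= !U0E//; exact: ltnW.
  have sq i : (i <= N)%N -> U 0%N i ^+ 2 <= uup ^+ 2.
    by move=> iN; have /andP[? ?] := ub0 0%N i iN; rewrite ler_sqr.
  have -> : alpha * uup ^+ 2 = alpha / 2 * (uup ^+ 2 + uup ^+ 2) by field.
  rewrite ler_pM2l ?divr_gt0//; apply: lerD; exact: sq.
have step k : b0 * D k.+1 + P k.+1 <= P k
    + alpha * (ud (k.+1%:R * tau) 0 * (U k.+1 0%N - U k 0%N)
               + ud (k.+1%:R * tau) ell * (U k.+1 N - U k N)).
  pose V i := U k.+1 i - U k i.
  have := scheme_nodal ell N alpha beta mu tau u0 ud u k.+1 hell N0 sch (ltn0Sn k) V.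
  rewrite -/h /=; set S := \sum_(i < N) _.
  (* By convexity of [M], the flux tested with the increment dominates the increase of the
     energy. *)
  have S1 : \sum_(i < N) h * M (slope h (U k.+1) i)
      - \sum_(i < N) h * M (slope h (U k) i) <= S.
    rewrite -sumrB; apply: ler_sum => i _; rewrite -mulrBr; apply: ler_wpM2l; first exact: ltW.
    have -> : slope h V i = slope h (U k.+1) i - slope h (U k) i by rewrite /slope /V; ring.
    have := Mm (slope h (U k.+1) i) (slope h (U k) i).
    by rewrite -/(slope h (U k.+1) i); lra.
  (* The strong monotonicity of [beta] is applied node by node, after the L^2 norm has been bounded
     by the trapezoidal rule. *)
  have m1 : b0 * D k.+1 <= mass h N
      (fun i => (beta (u k.+1 (node ell N i)) - beta (u k (node ell N i))) / tau * V i).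
    have Vd : Vh ell N (dtau tau u k.+1).
      by apply: (Vh_scale _ _ tau (u k.+1 \- u k)); apply: VhB; case: sch.
    have /andP[I1 _] := inner_sqr_bounds ell N _ hell N0 Vd.
    rewrite /D L2norm_sqr mulrA.
    apply: le_trans (ler_wpM2l (mulr_ge0 (ltW b00) (ltW tau0)) I1) _.
    rewrite -massZ; apply: mass_le => // i iN.
    have /andP[a1 a2] := ub k.+1 i iN; have /andP[a3 a4] := ub k i iN.
    have /andP[H _] := bb (U k.+1 i) (U k i) ltac:(rewrite /U; apply/andP; split; lra)
      ltac:(rewrite /U; apply/andP; split; lra).
    have -> : b0 * tau * dtau tau u k.+1 (node ell N i) ^+ 2 =
        tau^-1 * (b0 * (U k.+1 i - U k i) ^+ 2).
      by rewrite /dtau /U /=; field; rewrite gt_eqF.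
    by rewrite mulrAC [leRHS]mulrC ler_pM2l ?invr_gt0.
  (* Convexity of the square does for the boundary energy what convexity of [M] does for the
     flux. *)
  have sq (x y : R) : (x ^+ 2 - y ^+ 2) / 2 <= x * (x - y).
    by have := sqr_ge0 (x - y); rewrite !expr2; lra.
  have q0 := ler_wpM2l (ltW halpha) (sq (U k.+1 0%N) (U k 0%N)).
  have q1 := ler_wpM2l (ltW halpha) (sq (U k.+1 N) (U k N)).
  move: m1 S1; set m := mass _ _ _ => m1 S1 Eq; rewrite /P.
  by rewrite /V in Eq; rewrite -/(U k.+1 0%N) -/(U k.+1 N) in Eq; lra.
have tele n : b0 * (\sum_(k < n) D k.+1) + P n <= P 0%N
    + alpha * (\sum_(k < n) ud (k.+1%:R * tau) 0 * (U k.+1 0%N - U k 0%N)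
               + \sum_(k < n) ud (k.+1%:R * tau) ell * (U k.+1 N - U k N)).
  elim: n => [|n IH]; first by rewrite !big_ord0; lra.
  by rewrite !big_ord_recr/=; have := step n; lra.
have kt k : 0 <= k%:R * tau by rewrite mulr_ge0 ?ler0n ?ltW.
have kS k : k%:R * tau <= k.+1%:R * tau by rewrite ler_pM2r// ler_nat.
have kD k : k.+1%:R * tau - k%:R * tau = tau by rewrite -natr1; ring.
have work x L i : x = 0 \/ x = ell -> 0 <= L ->
    (forall s t, 0 <= s -> s <= t -> `|ud t x - ud s x| <= L * (t - s)) ->
    (i <= N)%N ->
    \sum_(k < K) ud (k.+1%:R * tau) x * (U k.+1 i - U k i) <= w L.
  move=> xb L_ge0 HL iN.
  apply: (discrete_work_le tau t0 L uup (fun k => ud (k%:R * tau) x) (U ^~ i)) => //.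
  - by move=> k; exact: ub0.
  - move=> k; have [_ /(_ _ (kt k))/andP[? ?] _] := hud x xb.
    by have ? := hulow; apply/andP; split; lra.
  - by move=> k; have := HL _ _ (kt k) (kS k); rewrite kD.
  - by move=> k tk; rewrite !bd//; exact: le_trans (kS k).
(* After the index shift the sum is that of [tele], and the final energy, being nonnegative, is
   dropped. *)
rewrite ler_pdivlMr// mulrC big_add1/= big_mkord.
have := tele K; have := work 0 L0 0%N (or_introl erefl) L00 HL0 (leq0n N).
have := work ell L1 N (or_intror erefl) L10 HL1 (leqnn N).
have := P_ge0 K; rewrite /D.
set X := \sum_(k < K) _; set Y := \sum_(k < K) _; set Z := \sum_(k < K) _ => PK HY HX HT.
have := ler_wpM2l (ltW halpha) (lerD HX HY).
by lra.
Qed.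

End Main.

(** Before [t0] the data may differ from [ubar], so decay is counted from times after [t0]. On the
    horizon [T] a constant absorbs a possible lack of decay; beyond it the equilibrium has to be
    nondegenerate. *)
Theorem theorem9 (R : realType) (ell alpha T t0 ulow uup : R)
    (beta mu u0 ubar : R -> R) (ud : R -> R -> R)
    (hell : 0 < ell) (halpha : 0 < alpha) (hT : 0 < T) (ht0 : 0 <= t0)
    (hbeta : constitutive beta) (hB : coercive (primitive0 beta))
    (hmu : constitutive mu) (hmu0 : mu 0 = 0)
    (hulow : 0 < ulow)
    (hu0 : initial_datum mu ell ulow uup u0)
    (hud : boundary_datum ell ulow uup ud)
    (hubar : forall x, x = 0 \/ x = ell -> ulow <= ubar x <= uup) :
  (exists c1 c2 : R, [/\ 0 < c1, 0 < c2 &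
    forall (N : nat) (tau : R) (u : nat -> R -> R) (uhat : R -> R),
      (0 < N)%N -> 0 < tau <= T ->
      (forall k : nat, t0 <= k%:R * tau ->
        forall x, x = 0 \/ x = ell -> ud (k%:R * tau) x = ubar x) ->
      discrete_scheme ell N alpha beta mu tau u0 ud u ->
      discrete_stationary ell N alpha mu ubar uhat ->
      forall j k : nat, (j <= k)%N -> t0 <= j%:R * tau ->
        k%:R * tau <= T \/ nondegenerate_equilibrium ell mu ubar ->
        L2norm ell (u k \- uhat)
        <= c1 * expR (- c2 * (k%:R * tau - j%:R * tau))
           * L2norm ell (u j \- uhat)])
  /\
  (exists C : R,
    forall (N : nat) (tau : R) (u : nat -> R -> R),
      (0 < N)%N -> 0 < tau ->
      (forall k : nat, t0 <= k%:R * tau ->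
        forall x, x = 0 \/ x = ell -> ud (k%:R * tau) x = ubar x) ->
      discrete_scheme ell N alpha beta mu tau u0 ud u ->
      forall K : nat,
        \sum_(1 <= k < K.+1) tau * L2norm ell (dtau tau u k) ^+ 2 <= C).
Proof.
split.
  exact: (exponential_decay _ _ _ _ _ _ _ _ _ _ _ hell halpha hbeta hmu hmu0 hulow hu0 hud hubar hT ht0).
exact: (time_difference_bound _ _ _ _ _ _ _ _ _ _ hell halpha hbeta hmu hmu0 hulow hu0 hud hubar ht0).
Qed.
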